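(* Work in the Soft-BCT model described in the context, with $\bm W$, the observed series $\bm x$ and the initial context fixed. Let the current variational distribution of $\bm U$ be $q(\bm U)=\prod_{t=1}^nq(\bm U_t)$ with $$q(\bm U_t)=\prod_{s\in\mathcal I_{\max}}\prod_{m=1}^M(\pi'_{t,s,s_m})^{I\{s_m\preceq\mathsf s(\bm U_t)\}},$$ where $\pi'_{t,s,s_m}\ge0$ and $\sum_{m=1}^M\pi'_{t,s,s_m}=1$ for all $t$ and $s\in\mathcal I_{\max}$. For $s\in\mathcal S_{\max}$ let $q_{s,t}:=\prod_{s',\,s'_{\mathrm{ch}}\preceq s}\pi'_{t,s',s'_{\mathrm{ch}}}$ (product over all parent–child pairs $(s',s'_{\mathrm{ch}})$ on the path from $s_\lambda$ to $s$; $q_{s_\lambda,t}=1$) and $\bm Q_s:=\mathrm{diag}\{q_{s,1},\dots,q_{s,n}\}$. Let $q(T,\bm\theta,\bm\tau)$ be the probability distribution determined by $$\ln q(T,\bm\theta,\bm\tau)=\mathbb E_{q(\bm U)}\bigl[\ln p(\bm x,\bm U,T,\bm\theta,\bm\tau\mid\bm W)\bigr]+\mathrm{const.},$$ where const. does not depend on $(T,\bm\theta,\bm\tau)$. Then $q(T,\bm\theta,\bm\tau)=q(T)\prod_{s\in\mathcal L_T}q(\bm\theta_s,\tau_s)$, where for each $s\in\mathcal L_T$ $$q(\bm\theta_s,\tau_s)=\mathcal N(\bm\theta_s\mid\bm\mu'_s,(\tau_s\bm\Lambda'_s)^{-1})\,\mathrm{Gam}(\tau_s\mid a'_s,b'_s),$$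 $$\bm\Lambda'_s:=\bm\Lambda+(\bm X^{\mathrm A})^\top\bm Q_s\bm X^{\mathrm A},\qquad \bm\mu'_s:=(\bm\Lambda'_s)^{-1}\bigl(\bm\Lambda\bm\mu+(\bm X^{\mathrm A})^\top\bm Q_s\bm x\bigr),$$ $$a'_s:=a+\tfrac12\mathrm{Tr}\{\bm Q_s\},\qquad b'_s:=b+\tfrac12\bigl(\bm\mu^\top\bm\Lambda\bm\mu+\bm x^\top\bm Q_s\bm x-(\bm\mu'_s)^\top\bm\Lambda'_s\bm\mu'_s\bigr),$$ and $$q(T)=\Bigl(\prod_{s\in\mathcal I_T}g'_s\Bigr)\Bigl(\prod_{s\in\mathcal L_T}(1-g'_s)\Bigr),$$ where $$g'_s:=\begin{cases}\dfrac{g_s\prod_{s_{\mathrm{ch}}\in\mathrm{Ch}(s)}\phi_{s_{\mathrm{ch}}}}{\phi_s},&s\in\mathcal I_{\max},\\0,&s\in\mathcal L_{\max},\end{cases}\qquad \phi_s:=\begin{cases}(1-g_s)\gamma_s+g_s\prod_{s_{\mathrm{ch}}\in\mathrm{Ch}(s)}\phi_{s_{\mathrm{ch}}},&s\in\mathcal I_{\max},\\\gamma_s,&s\in\mathcal L_{\max},\end{cases}$$ $$\ln\gamma_s=\tfrac12\ln|\bm\Lambda|-\tfrac12\ln|\bm\Lambda'_s|+a\ln b-a'_s\ln b'_s-\ln\Gamma(a)+\ln\Gamma(a'_s)-\tfrac12\mathrm{Tr}\{\bm Q_s\}\ln2\pi$$ (with $\bm\Lambda'_s,\bm\mu'_s,a'_s,b'_s,\gamma_s$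 defined by these formulas for all $s\in\mathcal S_{\max}$).
   Context: Trees. Let $M,D_{\max},J,K,n\in\mathbb N$ be positive. $T_{\max}$ is the $M$-ary perfect rooted tree of depth $D_{\max}$ with root $s_\lambda$; $\mathcal I_{\max}$, $\mathcal L_{\max}$ are its sets of inner nodes and leaves, $\mathcal S_{\max}=\mathcal I_{\max}\cup\mathcal L_{\max}$. For $s\in\mathcal I_{\max}$, $s_m$ is its $m$-th child ($1\le m\le M$), and $\mathrm{Ch}(s)$ is its set of children. $s'\preceq s$ means $s'$ is an ancestor of $s$ or $s'=s$. $\mathcal T$ is the set of regular subtrees $T$ of $T_{\max}$ with root $s_\lambda$ (each node of $T$ has either all of its $M$ children in $T$ or none); $\mathcal I_T,\mathcal L_T$ are the inner nodes and leaves of $T$. Context matrices. $\bm U_t=[\bm u_{t,0},\dots,\bm u_{t,D_{\max}-1}]^\top\in\{0,1\}^{D_{\max}\times M}$ has one-hot rows; its row for depth $d$ having a 1 in position $m$ means that the path from the root goes from its depth-$d$ node to that node's $m$-th child. $\mathsf s(\bm U_t)\in\mathcal L_{\max}$ is the leaf reached by this path. $\bm U=\{\bm U_t\}_{t=1}^n$. Model. Data: $\bm x=[x_1,\dots,x_n]^\top\in\mathbb R^n$ together with given initial values $x_{1-\max\{J,K\}},\dots,x_0\in\mathbb R$ (everything is conditional on these). $\bm x_t^{\mathrm L}=[1,x_{t-1},\dots,x_{t-J}]^\top$, $\bm x_t^{\mathrm A}=[1,x_{t-1},\dots,x_{t-K}]^\top$, and $\bm X^{\mathrm A}$ is the $n\times(K+1)$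 matrix with $t$-th row $(\bm x_t^{\mathrm A})^\top$. $\bm W=\{\bm W_s\}_{s\in\mathcal I_{\max}}$ with $\bm W_s\in\mathbb R^{M\times(J+1)}$. $\sigma_m(\bm v)=e^{v_m}/\sum_{i=1}^Me^{v_i}$. $I\{\cdot\}$ is the indicator function. The joint density is $$p(\bm x,\bm U,T,\bm\theta,\bm\tau\mid\bm W)=p(T)\,p(\bm\theta,\bm\tau\mid T)\prod_{t=1}^n p(\bm U_t\mid\bm W,\bm x_t^{\mathrm L})\,p(x_t\mid x^{t-1},\bm U_t,\bm\theta,\bm\tau,T),$$ where - $p(\bm U_t\mid\bm W,\bm x_t^{\mathrm L})=\prod_{s\in\mathcal I_{\max}}\prod_{m=1}^M\sigma_m(\bm W_s\bm x_t^{\mathrm L})^{I\{s_m\preceq\mathsf s(\bm U_t)\}}$; - $p(x_t\mid x^{t-1},\bm U_t,\bm\theta,\bm\tau,T)=\prod_{s\in\mathcal L_T}\mathcal N(x_t\mid(\bm x_t^{\mathrm A})^\top\bm\theta_s,\tau_s^{-1})^{I\{s\preceq\mathsf s(\bm U_t)\}}$, with $\bm\theta=\{\bm\theta_s\}_{s\in\mathcal L_T}$, $\bm\theta_s\in\mathbb R^{K+1}$, $\bm\tau=\{\tau_s\}_{s\in\mathcal L_T}$, $\tau_s>0$; - $p(T)=\prod_{s\in\mathcal I_T}g_s\prod_{s\in\mathcal L_T}(1-g_s)$, with $g_s\in[0,1]$ and $g_s=0$ for $s\in\mathcal L_{\max}$; - $p(\bm\theta,\bm\tau\mid T)=\prod_{s\in\mathcal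 L_T}\mathcal N(\bm\theta_s\mid\bm\mu,(\tau_s\bm\Lambda)^{-1})\,\mathrm{Gam}(\tau_s\mid a,b)$, with $\bm\mu\in\mathbb R^{K+1}$, $\bm\Lambda$ symmetric positive definite, $a,b>0$. Here $\mathcal N(\cdot\mid\text{mean},\text{(co)variance})$ is the Gaussian density and $\mathrm{Gam}(\tau\mid a,b)=\frac{b^a}{\Gamma(a)}\tau^{a-1}e^{-b\tau}$. Convention: $\ln0=-\infty$ (so trees with $p(T)=0$ get $q$-probability $0$). A distribution $q(T,\bm\theta,\bm\tau)$ is described by its density with respect to counting measure in $T\in\mathcal T$ and, given $T$, Lebesgue measure in $(\bm\theta,\bm\tau)$. *)

(* Defs.v *)
From HB Require Import structures.
From mathcomp Require Import all_boot all_order all_algebra.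
From mathcomp Require Import all_classical all_reals all_analysis.

Set Implicit Arguments.
Unset Strict Implicit.
Unset Printing Implicit Defensive.

Import Order.TTheory GRing.Theory Num.Theory.
Import numFieldNormedType.Exports.

Local Open Scope classical_set_scope.
Local Open Scope ring_scope.

(* The canonical sigma-finite structure of [m1 \x m2] in the library is keyed
   on subprobabilities, so the product is renamed to attach the general one. *)
Section product_measure.
Local Open Scope ereal_scope.
Context d1 d2 (X : measurableType d1) (Y : measurableType d2) (R : realType).
Context (m1 : {sigma_finite_measure set X -> \bar R})
  (m2 : {sigma_finite_measure set Y -> \bar R}).

Definition product_measure : set (X * Y)%type -> \bar R := m1 \x m2.

HB.instance Definition _ := Measure.on product_measure.

Let product_measure_sigma_finite : sigma_finite setT product_measure.
Proof.
have /sigma_finiteP[F [TF ndF Foo]] := sigma_finiteT m1.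
have /sigma_finiteP[G [TG ndG Goo]] := sigma_finiteT m2.
exists (fun n => F n `*` G n).
  rewrite -setXTT TF TG predeqE => -[u v]; split.
    move=> [/= [n _ Fnu] [k _ Gkv]]; exists (maxn n k) => //; split.
    - by move: u Fnu; exact/subsetPset/ndF/leq_maxl.
    - by move: v Gkv; exact/subsetPset/ndG/leq_maxr.
  by move=> [n _ []/= ? ?]; split; exists n.
move=> k; have [? ?] := Foo k; have [? ?] := Goo k.
split; first exact: measurableX.
by rewrite /product_measure product_measure1E// lte_mul_pinfty// ge0_fin_numE.
Qed.

HB.instance Definition _ := Measure_isSigmaFinite.Build _ _ _ product_measure
  product_measure_sigma_finite.

End product_measure.

Section tuple_measure.
Local Open Scope ereal_scope.
Context d (X : measurableType d) (R : realType).

Definition cons_pair n (p : X * n.-tuple X) : n.+1.-tuple X :=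
  [the n.+1.-tuple X of p.1 :: p.2].

Lemma measurable_cons_pair n : measurable_fun setT (@cons_pair n).
Proof. exact: measurable_cons. Qed.

Section cons_measure.
Context n (mu : {sigma_finite_measure set X -> \bar R})
  (nu : {sigma_finite_measure set (n.-tuple X) -> \bar R}).

Definition cons_measure : set (n.+1.-tuple X) -> \bar R :=
  pushforward (product_measure mu nu) (@cons_pair n).

Let cons_measure0 : cons_measure set0 = 0.
Proof. by rewrite /cons_measure /pushforward preimage_set0 measure0. Qed.

Let cons_measure_ge0 A : 0 <= cons_measure A.
Proof. exact: (measure_ge0 (product_measure mu nu)). Qed.

Let cons_measure_sigma_additive : semi_sigma_additive cons_measure.
Proof.
have mf := @measurable_cons_pair n.
move=> F mF tF mUF; rewrite /cons_measure /pushforward preimage_bigcup.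
apply: measure_semi_sigma_additive.
- by move=> k; rewrite -[X in measurable X]setTI; exact: mf.
- apply/trivIsetP => /= i j _ _ ij; rewrite -preimage_setI.
  by move/trivIsetP : tF => /(_ _ _ _ _ ij) ->//; rewrite preimage_set0.
- by rewrite -preimage_bigcup -[X in measurable X]setTI; exact: mf.
Qed.

HB.instance Definition _ := isMeasure.Build _ _ _ cons_measure
  cons_measure0 cons_measure_ge0 cons_measure_sigma_additive.

Let cons_measure_sigma_finite : sigma_finite setT cons_measure.
Proof.
have [F FT Foo] := sigma_finiteT (product_measure mu nu).
pose uncons (t : n.+1.-tuple X) := (thead t, [tuple of behead t]).
have unconsK p : uncons (cons_pair p) = p.
  by case: p => x t; rewrite /uncons theadE; congr pair; apply: val_inj.
have muncons : measurable_fun setT uncons.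
  apply/measurable_fun_pairP; split; last exact: measurable_behead.
  exact: measurable_tnth.
exists (fun i => uncons @^-1` F i) => [|i].
  by rewrite -preimage_bigcup -FT preimage_setT.
have [mFi Fioo] := Foo i; split.
  by rewrite -[X in measurable X]setTI; exact: muncons.
rewrite /cons_measure /pushforward -comp_preimage.
by rewrite (_ : uncons \o _ = id) //; apply/funext => p; exact: unconsK.
Qed.

HB.instance Definition _ := Measure_isSigmaFinite.Build _ _ _ cons_measure
  cons_measure_sigma_finite.

End cons_measure.

Fixpoint tuple_measure (mu : {sigma_finite_measure set X -> \bar R}) (n : nat) :
    {sigma_finite_measure set (n.-tuple X) -> \bar R} :=
  match n with
  | 0 => [the {sigma_finite_measure set (0.-tuple X) -> \bar R} of
            \d_([tuple] : 0.-tuple X)]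
  | n'.+1 => [the {sigma_finite_measure set (n'.+1.-tuple X) -> \bar R} of
            cons_measure mu (tuple_measure mu n')]
  end.

End tuple_measure.

Section densities.
Context {R : realType}.

Definition Gamma (a : R) : R :=
  \int[lebesgue_measure]_(t in `]0, +oo[) (t `^ (a - 1) * expR (- t)).

Definition gamma_pdf (a b t : R) : R :=
  b `^ a / Gamma a * t `^ (a - 1) * expR (- (b * t)).

(* [S] is the covariance matrix. *)
Definition mvnormal_pdf k (m : 'cV[R]_k) (S : 'M[R]_k) (v : 'cV[R]_k) : R :=
  (Num.sqrt ((2 * pi) ^+ k * \det S))^-1 *
  expR (- (2^-1 * ((v - m)^T *m invmx S *m (v - m)) 0 0)).

Definition posdefmx k (A : 'M[R]_k) : Prop :=
  A^T = A /\ forall v : 'cV[R]_k, v != 0 -> 0 < (v^T *m A *m v) 0 0.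

Definition softmax k (v : 'cV[R]_k) (i : 'I_k) : R :=
  expR (v i 0) / \sum_(j < k) expR (v j 0).

End densities.

Section trees.
Context {M D : nat}.

(* A node is the sequence of branch indices on the path from the root to it. *)
Definition node := D.-bseq 'I_M.

Definition root_node : node := [bseq].

Definition inner (s : node) : bool := (size s < D)%N.

Definition prec (s' s : node) : bool := prefix s' s.

(* Meaningful for inner [s] only: the value at a leaf is the root. *)
Definition child (s : node) (m : 'I_M) : node := insub_bseq D (rcons s m).

Definition regular_subtree (T : {set node}) : bool :=
  [&& root_node \in T,
      [forall s in T, [forall s', prec s' s ==> (s' \in T)]] &
      [forall s in T, inner s ==>
         ([forall m, child s m \in T] || [forall m, child s m \notin T])]].

Definition tree := {T : {set node} | regular_subtree T}.

Definition inners (T : tree) : {set node} :=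
  [set s in val T | inner s && [exists m, child s m \in val T]].

Definition leaves (T : tree) : {set node} := val T :\: inners T.

Definition leaf (T : tree) := {s : node | s \in leaves T}.

Definition context :=
  {U : 'M[bool]_(D, M) | [forall d, #|[set m | U d m]| == 1%N]}.

(* The depth-[D] node whose path follows, at each depth [d], the position of
   the 1 in row [d]. *)
Definition context_leaf (U : context) : node :=
  insub_bseq D (pmap (fun d => [pick m | val U d m]) (enum 'I_D)).

End trees.

Arguments node : clear implicits.
Arguments tree : clear implicits.
Arguments context : clear implicits.

Section parameters.
Context {M D : nat} (R : realType) (K : nat).

(* Only the points with all [tau > 0], i.e. those of [param_dom] below, are
   actual parameters. *)
Definition param (T : tree M D) :=
  #|{: leaf T}|.-tuple
    (K.+1.-tuple (measurableTypeR R) * measurableTypeR R)%type.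

Definition theta T (p : param T) (s : leaf T) : 'cV[R]_K.+1 :=
  \col_i tnth (tnth p (enum_rank s)).1 i.

Definition tau T (p : param T) (s : leaf T) : R := (tnth p (enum_rank s)).2.

Definition param_dom T : set (param T) :=
  [set p | forall s : leaf T, 0 < tau p s].

Definition param_lebesgue T : {measure set (param T) -> \bar R} :=
  tuple_measure
    [the {sigma_finite_measure set _ -> \bar R} of
        product_measure (tuple_measure (@lebesgue_measure R) K.+1)
          (@lebesgue_measure R)]
    #|{: leaf T}|.

(* Probability densities with respect to counting measure in [T] and, given
   [T], Lebesgue measure in [(theta, tau)]. *)
Definition is_density (q : forall T : tree M D, param T -> R) : Prop :=
  [/\ forall T p, param_dom p -> 0 <= q T p,
      forall T, measurable_fun (@param_dom T) (q T) &
      (\sum_(T : tree M D)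
         \int[param_lebesgue T]_(p in @param_dom T) (q T p)%:E = 1)%E].

End parameters.

Section model.
Context {R : realType} {M D J K n h : nat}.
Implicit Types (T : tree M D) (s : node M D).
Context (x0 : 'cV[R]_h) (x : 'cV[R]_n).

(* [x0] holds [x_(1-h), ..., x_0] and [x] holds [x_1, ..., x_n], so that [x_i]
   is the entry of index [i + h - 1] of [col_mx x0 x]. *)
Definition series_entry (k : nat) : R :=
  if insub k is Some i then col_mx x0 x i 0 else 0.

(* [1, x_(t-1), ..., x_(t-L)] for [L <= h]; as an ordinal, [t] counts from 0. *)
Definition regressor L (t : 'I_n) : 'cV[R]_L.+1 :=
  \col_(j < L.+1) if j == 0 :> nat then 1 else series_entry (h + t - j)%N.

Definition design L : 'M[R]_(n, L.+1) := \matrix_(t < n) (regressor L t)^T.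

Definition prior_tree (g : node M D -> R) T : R :=
  (\prod_(s in inners T) g s) * \prod_(s in leaves T) (1 - g s).

Definition prior_param (mu : 'cV[R]_K.+1) (Lam : 'M[R]_K.+1) (a b : R)
    T (p : param R K T) : R :=
  \prod_(s : leaf T)
    (mvnormal_pdf mu (invmx (tau p s *: Lam)) (theta p s) *
     gamma_pdf a b (tau p s)).

Definition context_density (W : node M D -> 'M[R]_(M, J.+1))
    (t : 'I_n) (U : context M D) : R :=
  \prod_(s : node M D | inner s) \prod_(m < M)
    softmax (W s *m regressor J t) m ^+ prec (child s m) (context_leaf U).

(* [normal_pdf] takes the standard deviation. *)
Definition obs_density T (p : param R K T) (t : 'I_n) (U : context M D) : R :=
  \prod_(s : leaf T)
    normal_pdf (((regressor K t)^T *m theta p s) 0 0)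
      (Num.sqrt (tau p s)^-1) (x t 0) ^+ prec (val s) (context_leaf U).

Definition joint_density W g mu Lam a b T (p : param R K T)
    (U : {ffun 'I_n -> context M D}) : R :=
  prior_tree g T * prior_param mu Lam a b p *
  \prod_(t < n) (context_density W t (U t) * obs_density p t (U t)).

Section update.
Context (pi' : 'I_n -> node M D -> 'I_M -> R).

Definition q_context (t : 'I_n) (U : context M D) : R :=
  \prod_(s : node M D | inner s) \prod_(m < M)
    pi' t s m ^+ prec (child s m) (context_leaf U).

Definition q_contexts (U : {ffun 'I_n -> context M D}) : R :=
  \prod_(t < n) q_context t (U t).

(* [lne 0 = -oo], and [0 * -oo = 0] for extended reals. *)
Definition expected_log_joint W g mu Lam a b T (p : param R K T) : \bar R :=
  (\sum_(U : {ffun 'I_n -> context M D})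
    (q_contexts U)%:E * lne (joint_density W g mu Lam a b p U)%:E)%E.

Definition is_variational_update W g mu Lam a b
    (q : forall T : tree M D, param R K T -> R) : Prop :=
  is_density q /\
  exists c : R, forall T (p : param R K T), param_dom p ->
    lne (q T p)%:E = (expected_log_joint W g mu Lam a b p + c%:E)%E.

Definition q_node s (t : 'I_n) : R :=
  \prod_(s' : node M D | inner s') \prod_(m < M | prec (child s' m) s)
    pi' t s' m.

Definition Qmx s : 'M[R]_n := diag_mx (\row_t q_node s t).

Context (g : node M D -> R) (mu : 'cV[R]_K.+1) (Lam : 'M[R]_K.+1) (a b : R).

Definition post_Lam s : 'M[R]_K.+1 :=
  Lam + (design K)^T *m Qmx s *m design K.

Definition post_mu s : 'cV[R]_K.+1 :=
  invmx (post_Lam s) *m (Lam *m mu + (design K)^T *m Qmx s *m x).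

Definition post_a s : R := a + 2^-1 * \tr (Qmx s).

Definition post_b s : R :=
  b + 2^-1 * (mu^T *m Lam *m mu + x^T *m Qmx s *m x
              - (post_mu s)^T *m post_Lam s *m post_mu s) 0 0.

Definition evidence s : R :=
  expR (2^-1 * ln (\det Lam) - 2^-1 * ln (\det (post_Lam s))
        + a * ln b - post_a s * ln (post_b s)
        - ln (Gamma a) + ln (Gamma (post_a s))
        - 2^-1 * \tr (Qmx s) * ln (2 * pi)).

(* [k] is the height of [s], that is [D - size s]. *)
Fixpoint phi_rec (k : nat) s : R :=
  if k is k'.+1 then
    (1 - g s) * evidence s + g s * \prod_(m < M) phi_rec k' (child s m)
  else evidence s.

Definition phi s : R := phi_rec (D - size s) s.

Lemma phiE s : phi s =
  if inner s then
    (1 - g s) * evidence s + g s * \prod_(m < M) phi (child s m)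
  else evidence s.
Proof.
rewrite /phi /inner; case: ltnP => [sD|]; last by rewrite -subn_eq0 => /eqP ->.
rewrite -(subnSK sD) /=; congr (_ + _ * _); apply: eq_bigr => m _.
by rewrite /child /insub_bseq val_insubd size_rcons sD size_rcons.
Qed.

Definition post_g s : R :=
  if inner s then g s * \prod_(m < M) phi (child s m) / phi s else 0.

End update.

End model.

(* Main.v *)
Require Import Defs.
From mathcomp Require Import all_boot all_order all_algebra.
From mathcomp Require Import all_classical all_reals all_analysis.
From mathcomp Require Import measurable_realfun ring lra.

(* Conditionally on [T], the exponent of the update is a sum over the leaves
   [s] of [T] of the log of the normal-gamma prior plus the log-likelihood of
   the observations weighted by [q_node s t], because [q_node s t] is the
   [q_contexts]-probability that the path of [U_t] passes through [s].
   Completing the square turns each summand into the log of a normalized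
   normal-gamma density plus [ln (evidence s)].  Integrating out the parameters
   leaves the weight [prior_tree T * \prod_(s in leaves T) evidence s]; in terms
   of [g'] this weight telescopes to [phi root_node] times the law of the tree
   grown by splitting each inner node [s] with probability [g' s], so that the
   normalizing constant is [phi root_node]. *)

Set Implicit Arguments.
Unset Strict Implicit.
Unset Printing Implicit Defensive.

Import Order.TTheory GRing.Theory Num.Theory.
Import numFieldNormedType.Exports.

Local Open Scope classical_set_scope.
Local Open Scope ring_scope.

(** * Tonelli for tuple measures *)

Section tonelli.
Local Open Scope ereal_scope.

(** [Gamma] is a real-valued integral, so divergence would silently turn it into 0: its convergence
    and positivity must be settled before any normal-gamma density can be normalized. Densities are
    put in the form of a single exponential, with exponents built from logarithms and quadratic
    forms, so that identities between densities become ring identities between exponents. They make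
    sense for positive precisions only; extended by zero elsewhere, they become products over the
    coordinates of the whole tuple space, to which Tonelli applies. The additive constant of the
    update is forced by total mass 1; a single equivalence therefore yields both existence and
    uniqueness. *)

Lemma ge0_integral_product_measure d1 d2 (X : measurableType d1)
    (Y : measurableType d2) (R : realType)
    (m1 : {sigma_finite_measure set X -> \bar R})
    (m2 : {sigma_finite_measure set Y -> \bar R}) (f : X * Y -> \bar R) :
  measurable_fun setT f -> (forall z, 0 <= f z) ->
  \int[product_measure m1 m2]_z f z = \int[m2]_y \int[m1]_x f (x, y).
Proof. move=> mf f0.
transitivity (\int[m1]_x \int[m2]_y f (x, y)).
  exact: (@fubini_tonelli1 _ _ _ _ R m1 m2 f mf f0).
exact: (@fubini_tonelli _ _ _ _ R m1 m2 f mf f0). Qed.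

Lemma ge0_integral_cons_measure d (X : measurableType d) (R : realType) n
    (mu : {sigma_finite_measure set X -> \bar R})
    (nu : {sigma_finite_measure set (n.-tuple X) -> \bar R})
    (f : n.+1.-tuple X -> \bar R) :
  measurable_fun setT f -> (forall z, 0 <= f z) ->
  \int[cons_measure mu nu]_z f z =
  \int[nu]_t \int[mu]_x f (cons_pair (x, t)).
Proof.
move=> mf f0.
have mc := @measurable_cons_pair _ X n.
rewrite -(@ge0_integral_product_measure _ _ _ _ _ mu nu
  (fun p => f (cons_pair p)))//; last exact: measurableT_comp.
exact: (@ge0_integral_pushforward _ _ _ _ R _ mc (product_measure mu nu) setT
  f).
Qed.

(** Induction on [n], peeling off the first coordinate. The base case is the Dirac mass at the empty
    tuple, where the empty product is 1. *)
Lemma ge0_integral_tuple_measure d (X : measurableType d) (R : realType)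
    (mu : {sigma_finite_measure set X -> \bar R}) n (f : 'I_n -> X -> R) :
  (forall i, measurable_fun setT (f i)) -> (forall i x, (0 <= f i x)%R) ->
  \int[tuple_measure mu n]_p (\prod_(i < n) f i (tnth p i))%:E =
  \prod_(i < n) \int[mu]_x (f i x)%:E.
Proof.
have mprod k (h : 'I_k -> X -> R) : (forall i, measurable_fun setT (h i)) ->
    measurable_fun setT (fun p : k.-tuple X => \prod_(i < k) h i (tnth p i))%R.
  move=> mh; apply: measurable_prod => i _ /=.
  by apply: (measurableT_comp (mh i)); exact: measurable_tnth.
elim: n f => [|n IH] f mf f0.
  rewrite /= integral_dirac//=; last first.
    by apply/measurable_EFinP; exact: mprod.
  by rewrite diracE mem_set// mul1e !big_ord0.
transitivity (\int[tuple_measure mu n]_t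
    \int[mu]_x (\prod_(i < n.+1) f i (tnth (cons_pair (x, t)) i))%:E).
  apply: (@ge0_integral_cons_measure _ X R n mu (tuple_measure mu n)
    (fun p => (\prod_(i < n.+1) f i (tnth p i))%:E)).
    by apply/measurable_EFinP; exact: mprod.
  by move=> p; rewrite lee_fin prodr_ge0.
pose F (t : n.-tuple X) := (\prod_(i < n) f (lift ord0 i) (tnth t i))%R.
transitivity (\int[tuple_measure mu n]_t
    ((\int[mu]_x (f ord0 x)%:E) * (F t)%:E)).
  apply: eq_integral => t _.
  transitivity (\int[mu]_x ((F t)%:E * (f ord0 x)%:E)).
    apply: eq_integral => x _; rewrite big_ord_recl tnth0 mulrC -EFinM.
    by congr ((_ * _)%:E); apply: eq_bigr => i _; rewrite tnthS.
  rewrite ge0_integralZl//; first by rewrite muleC.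
  - exact/measurable_EFinP.
  - by move=> x _; rewrite lee_fin.
  - by rewrite lee_fin prodr_ge0.
rewrite ge0_integralZl//; last 3 first.
- by apply/measurable_EFinP; exact: (mprod _ (fun i => f (lift ord0 i))).
- by move=> t _; rewrite lee_fin prodr_ge0.
- by apply: integral_ge0 => x _; rewrite lee_fin.
by rewrite (IH (fun i => f (lift ord0 i)))// big_ord_recl.
Qed.

End tonelli.

(** * The Gamma integral *)

Section gamma.
Context {R : realType}.
Local Notation mu := (@lebesgue_measure R).
Implicit Types a b c t : R.

Lemma measurable_mulr c :
  measurable_fun setT ( *%R c : measurableTypeR R -> measurableTypeR R).
Proof. by apply: measurable_funM. Qed.

(** By uniqueness of Lebesgue measure: [c] times the pushforward gives every interval []u, v]] its
    length. *)
Lemma lebesgue_measure_scale c (A : set (measurableTypeR R)) : 0 < c ->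
  measurable A ->
  (pushforward mu ( *%R c : measurableTypeR R -> measurableTypeR R) A =
   c^-1%:E * mu A)%E.
Proof.
move=> c0 mA; pose ci : {nonneg R} := NngNum (ltW c0).
have mc := measurable_mulr c.
pose f : measurableTypeR R -> measurableTypeR R := *%R c.
pose nu0 : {measure set (measurableTypeR R) -> \bar R} :=
  mscale ci (pushforward mu f).
pose nu := nu0 mc.
suff -> : (mu A = nu A)%E.
  by rewrite /nu/= /mscale/= muleA -EFinM mulVf ?gt_eqF// mul1e.
apply: lebesgue_measure_unique => // _ [[u v] _ <-].
rewrite /nu/= /mscale /pushforward/=.
rewrite [X in (_ = _ * mu X)%E](_ : _ = `]u / c, v / c]%classic); last first.
  by apply/seteqP; split => x /=; rewrite /f !in_itv/= ltr_pdivrMr//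
    ler_pdivlMr// (mulrC x).
rewrite !lebesgue_measure_itv/= !lte_fin ltr_pM2r ?invr_gt0//.
case: ifP => _; last by rewrite mule0.
by rewrite -!EFinB -EFinM -mulrBl mulrCA divff ?mulr1// gt_eqF.
Qed.

Lemma ge0_integral_scale c (f : R -> \bar R) : 0 < c ->
  measurable_fun (`]0, +oo[%classic : set R) f ->
  (forall x, 0 < x -> (0 <= f x)%E) ->
  (\int[mu]_(x in `]0%R, +oo[) f (c * x)%R =
   c^-1%:E * \int[mu]_(x in `]0%R, +oo[) f x)%E.
Proof.
move=> c0 mf f0.
have mc := measurable_mulr c.
have E : `]0, +oo[%classic =
    ( *%R c : measurableTypeR R -> measurableTypeR R) @^-1` `]0, +oo[.
  by apply/seteqP; split => x /=; rewrite !in_itv/= !andbT pmulr_rgt0.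
have f0' : {in (`]0, +oo[%classic : set R), forall y, (0 <= f y)%E}.
  by move=> y; rewrite inE /= in_itv/= andbT => /f0.
rewrite {1}E -(@ge0_integral_pushforward _ _ _ _ R _ mc mu `]0, +oo[ f)//.
have ci : 0 <= c^-1 by rewrite invr_ge0 ltW.
rewrite -(@ge0_integral_mscale _ _ R mu _ (measurable_itv _) (NngNum ci))//.
  apply: eq_measure_integral => A mA _.
  exact: lebesgue_measure_scale.
by move=> x; rewrite /= in_itv/= andbT => /f0.
Qed.

Definition gamma_fun a t : R := t `^ (a - 1) * expR (- t).

Lemma gamma_funE a t : 0 < t -> gamma_fun a t = expR ((a - 1) * ln t - t).
Proof. by move=> t0; rewrite /gamma_fun /powR gt_eqF// -expRD. Qed.

Lemma gamma_fun_ge0 a t : 0 <= gamma_fun a t.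
Proof. by rewrite /gamma_fun mulr_ge0 ?powR_ge0 ?expR_ge0. Qed.

Lemma measurable_gamma_fun a : measurable_fun setT (gamma_fun a).
Proof.
apply: measurable_funM; first exact: measurable_powR.
by apply: measurableT_comp => //; exact: measurable_funN.
Qed.

(* For positive arguments [F a] lies in [0, 1] and its derivative [f a] dominates
   [gamma_fun a] up to a constant. *)
Let F a t := expR (a * (ln t - ln (1 + t))).
Let f a t := F a t * (a * (t^-1 - (1 + t)^-1)).

Let is_deriveF a t : 0 < t -> is_derive t 1 (F a) (f a t).
Proof.
move=> t0; have t1 : 0 < 1 + t by rewrite addr_gt0.
have d1 : is_derive t 1 (fun t => ln (1 + t)) (1 + t)^-1.
  have d0 : is_derive t 1 (+%R 1) (1 : R).
    by rewrite -[X in is_derive _ _ _ X]add0r; apply: is_deriveD.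
  by have := is_derive1_comp (is_derive1_ln t1) d0; rewrite mulr1.
have d2 := is_derive1_ln t0.
have d3 : is_derive t 1 (fun t => a * (ln t - ln (1 + t)))
    (a * (t^-1 - (1 + t)^-1)).
  by apply: is_deriveZ; apply: is_deriveB.
exact: (is_derive1_comp (is_derive_expR _) d3).
Qed.

(** Here [f a t] is [a * t^(a - 1) / (1 + t)^(a + 1)], so the quotient [gamma_fun a t / f a t] is
    [(1 + t)^(a + 1) * exp (- t) / a]; its maximum, at [t = a], is the constant. *)
Let gamma_fun_le a t : 0 < a -> 0 < t -> gamma_fun a t <=
  (expR ((a + 1) * ln (a + 1) - a) / a) * f a t.
Proof.
move=> a0 t0; have t1 : 0 < 1 + t by rewrite addr_gt0.
have a1 : 0 < a + 1 by rewrite addr_gt0.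
have -> : (expR ((a + 1) * ln (a + 1) - a) / a) * f a t =
  expR ((a + 1) * ln (a + 1) - a + (a - 1) * ln t - (a + 1) * ln (1 + t)).
  rewrite /f /F.
  have -> : a * (t^-1 - (1 + t)^-1) = a * expR (- ln t - ln (1 + t)).
    rewrite expRD !expRN !lnK ?posrE//; field.
    by rewrite !gt_eqF.
  have E x y z : x / a * (y * (a * z)) = x * y * z by field; rewrite gt_eqF.
  by rewrite E -!expRD; congr expR; ring.
rewrite gamma_funE// ler_expR.
suff : (a + 1) * ln (1 + t) <= (a + 1) * ln (a + 1) + t - a by lra.
(* The bound [ln y <= y - 1], normalized to be an equality at the maximizer [t = a]. *)
have : ln ((1 + t) / (a + 1)) <= (1 + t) / (a + 1) - 1.
  have h : -1 < (1 + t) / (a + 1) - 1 by rewrite ltrDr divr_gt0.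
  by have := le_ln1Dx h; rewrite addrC subrK.
rewrite ln_div ?posrE// -(ler_pM2l a1) !mulrBr mulrCA divff ?gt_eqF// mulr1.
lra.
Qed.

(** The integral of [f a] is an increment of [F a], hence at most 1; the resulting bound is uniform
    in [u] and [v] and survives the passage to the half-line. *)
Let integral_gamma_fun_le a u v : 0 < a -> 0 < u -> u < v ->
  (\int[mu]_(t in `[u, v]) (gamma_fun a t)%:E <=
   (expR ((a + 1) * ln (a + 1) - a) / a)%:E)%E.
Proof.
move=> a0 u0 uv; set C := (_ / _).
have C0 : 0 <= C by rewrite divr_ge0 ?expR_ge0// ltW.
have itv0 t : t \in `[u, v] -> 0 < t.
  by rewrite in_itv/= => /andP[ut _]; exact: lt_le_trans ut.
have f0 t : 0 < t -> 0 <= f a t.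
  move=> t0; rewrite mulr_ge0 ?expR_ge0// mulr_ge0 ?(ltW a0)// subr_ge0.
  by rewrite lef_pV2 ?posrE ?addr_gt0// lerDr.
have dF t : 0 < t -> derivable (F a) t 1.
  by move=> t0; have [] := is_deriveF a t0.
have cF t : 0 < t -> {for t, continuous (F a)}.
  by move=> t0; apply: differentiable_continuous; exact/derivable1_diffP/dF.
have cf : {within `[u, v], continuous (f a)}.
  apply: continuous_in_subspaceT => t; rewrite inE => /itv0 t0.
  apply: cvgM; first exact: cF.
  apply: cvgM; first exact: cvg_cst.
  have c1 : 1 + x @[x --> t] --> 1 + t by apply: cvgD => //; exact: cvg_cst.
  by apply: cvgB; apply: cvgV => //; rewrite gt_eqF ?addr_gt0.
have mfE : measurable_fun `[u, v] (f a).
  by exact: subspace_continuous_measurable_fun.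
apply: (@le_trans _ _ (\int[mu]_(t in `[u, v]) (C%:E * (f a t)%:E))%E).
  apply: ge0_le_integral => //.
  - by move=> t _; rewrite lee_fin gamma_fun_ge0.
  - apply/measurable_EFinP.
    by apply: measurable_funS (measurable_gamma_fun a).
  - by apply: measurable_funeM; exact/measurable_EFinP.
  - by move=> t /itv0 t0; rewrite -EFinM lee_fin gamma_fun_le.
rewrite ge0_integralZl//; last 2 first.
- exact/measurable_EFinP.
- by move=> t /itv0 t0; rewrite lee_fin f0.
rewrite (@continuous_FTC2 _ _ (F a))//; last 2 first.
- split.
  + by move=> t ht; apply/dF/itv0; apply: subset_itv_oo_cc ht.
  + exact/cvg_at_right_filter/cF.
  + exact/cvg_at_left_filter/cF/(lt_trans u0).
- move=> t ht; rewrite derive1E; apply/derive_val/is_deriveF/itv0.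
  exact: subset_itv_oo_cc ht.
rewrite -EFinB -EFinM lee_fin ler_piMr//.
rewrite lerBlDr (@le_trans _ _ 1) ?lerDl ?expR_ge0//.
have v0 := lt_trans u0 uv.
rewrite /F -[leRHS]expR0 ler_expR pmulr_rle0// subr_le0 ler_ln ?posrE
  ?addr_gt0//.
by rewrite lerDr.
Qed.

Lemma integral_gamma_fun_lty a : 0 < a ->
  (\int[mu]_(t in `]0%R, +oo[) (gamma_fun a t)%:E < +oo)%E.
Proof.
(* [n.+2] rather than [n.+1] keeps the endpoints distinct already for [n = 0]. *)
move=> a0; pose B n : set R := `[n.+2%:R^-1, n.+2%:R]%classic.
have -> : `]0%R, +oo[%classic = \bigcup_n B n.
  apply/seteqP; split => t /=; rewrite in_itv/= andbT.
    move=> t0; exists (maxn (Num.truncn t) (Num.truncn t^-1)) => //=.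
    rewrite /B /= in_itv/=; apply/andP; split.
      rewrite -[leRHS]invrK lef_pV2 ?posrE ?invr_gt0//.
      apply: ltW; apply: lt_le_trans (truncnS_gt _) _.
      by rewrite ler_nat ltnS leqW// leq_maxr.
    apply: ltW; apply: lt_le_trans (truncnS_gt _) _.
    by rewrite ler_nat ltnS leqW// leq_maxl.
  by move=> [n _]; rewrite /B/= in_itv/= => /andP[+ _]; exact: lt_le_trans.
have mg (D : set (measurableTypeR R)) : measurable_fun D (EFin \o gamma_fun a).
  by apply/measurable_EFinP; apply: measurable_funS (measurable_gamma_fun a).
have ndB : nondecreasing_seq B.
  move=> m n mn; apply/subsetPset => t; rewrite /B/= !in_itv/= => /andP[h1 h2].
  rewrite (le_trans _ h1) ?(le_trans h2) ?ler_nat ?ltnS//.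
  by rewrite lef_pV2 ?posrE// ler_nat !ltnS.
have := @ge0_nondecreasing_set_cvg_integral _ (measurableTypeR R) R B
  (EFin \o gamma_fun a) mu ndB
  (fun=> measurable_itv _) (fun n => mg (B n))
  (fun n t _ => gamma_fun_ge0 a t).
move=> cvB; rewrite -(cvg_lim _ cvB)//.
apply: (@le_lt_trans _ _ (expR ((a + 1) * ln (a + 1) - a) / a)%:E);
  last exact: ltry.
apply: lime_le; first by apply/cvg_ex; eexists; exact: cvB.
apply: nearW => n; apply: integral_gamma_fun_le => //.
by rewrite (@lt_trans _ _ 1)// ?ltr1n// invf_lt1// ltr1n.
Qed.

(** [Gamma] truncates an extended integral to a real number; finiteness of the integral ensures that
    nothing is lost. *)
Lemma GammaE a : 0 < a ->
  (\int[mu]_(t in `]0%R, +oo[) (gamma_fun a t)%:E = (Gamma a)%:E)%E.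
Proof.
move=> a0; rewrite /Gamma /Rintegral fineK//.
rewrite ge0_fin_numE; first exact: integral_gamma_fun_lty.
by apply: integral_ge0 => t _; rewrite lee_fin gamma_fun_ge0.
Qed.

Lemma Gamma_gt0 a : 0 < a -> 0 < Gamma a.
Proof.
move=> a0; rewrite -lte_fin -GammaE//.
(* A lower bound of the integrand on [[1, 2]], where [ln t] lies between 0 and [ln 2]. *)
pose c := expR (- `|a - 1| * ln 2 - 2).
have mg (D : set (measurableTypeR R)) : measurable_fun D (EFin \o gamma_fun a).
  by apply/measurable_EFinP; apply: measurable_funS (measurable_gamma_fun a).
apply: (@lt_le_trans _ _ (\int[mu]_(t in `[1%R, 2%R]) c%:E)%E).
  rewrite integral_cst//= lebesgue_measure_itv/= lte_fin ltr1n -EFinB -EFinM.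
  by rewrite lte_fin mulr_gt0 ?expR_gt0// subr_gt0 ltr1n.
apply: (@le_trans _ _ (\int[mu]_(t in `[1%R, 2%R]) (gamma_fun a t)%:E)%E).
  apply: ge0_le_integral => //.
  - by move=> t _; rewrite lee_fin expR_ge0.
  move=> t; rewrite /= in_itv/= => /andP[t1 t2].
  have t0 : 0 < t := lt_le_trans ltr01 t1.
  rewrite lee_fin gamma_funE// ler_expR lerD ?lerN2//.
  have lt0 : 0 <= ln t by rewrite ln_ge0.
  apply: (@le_trans _ _ (- `|a - 1| * ln t)).
    by rewrite !mulNr lerN2 ler_wpM2l// ler_ln ?posrE.
  by rewrite ler_wpM2r// lerNl -normrN ler_norm.
apply: ge0_subset_integral => //.
- by move=> t _; rewrite lee_fin gamma_fun_ge0.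
- move=> t; rewrite /= !in_itv/= andbT => /andP[t1 _].
  exact: lt_le_trans ltr01 t1.
Qed.

Lemma gamma_pdf_ge0 a b t : 0 < a -> 0 <= gamma_pdf a b t.
Proof.
move=> a0; rewrite /gamma_pdf !mulr_ge0 ?powR_ge0 ?expR_ge0// invr_ge0.
exact/ltW/Gamma_gt0.
Qed.

Lemma gamma_pdfE a b t : 0 < a -> 0 < b -> 0 < t -> gamma_pdf a b t =
  expR (a * ln b - ln (Gamma a) + (a - 1) * ln t - b * t).
Proof.
move=> a0 b0 t0; rewrite /gamma_pdf /powR !gt_eqF//.
rewrite -{1}(lnK (Gamma_gt0 a0)) -expRN -!expRD.
by congr expR; ring.
Qed.

(** [gamma_pdf a b t] is [b / Gamma a * gamma_fun a (b * t)], and rescaling by [b] absorbs the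
    factor [b]. *)
Lemma integral_gamma_pdf a b : 0 < a -> 0 < b ->
  (\int[mu]_(t in `]0%R, +oo[) (gamma_pdf a b t)%:E = 1)%E.
Proof.
move=> a0 b0; have Ga0 := Gamma_gt0 a0.
transitivity (\int[mu]_(t in `]0%R, +oo[)
    ((b / Gamma a)%:E * (gamma_fun a (b * t))%:E))%E.
  apply: eq_integral => t; rewrite inE/= in_itv/= andbT => t0.
  rewrite -EFinM; congr EFin; rewrite gamma_pdfE// gamma_funE ?mulr_gt0//.
  have -> : b / Gamma a = expR (ln b - ln (Gamma a)).
    by rewrite expRD expRN !lnK.
  rewrite -!expRD lnM ?posrE//; congr expR; ring.
have mg : measurable_fun setT (EFin \o gamma_fun a).
  by apply/measurable_EFinP; exact: measurable_gamma_fun.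
rewrite ge0_integralZl//; last 3 first.
- apply: measurable_funTS; apply/measurable_EFinP.
  apply: measurableT_comp; first exact: measurable_gamma_fun.
  exact: measurable_funM.
- by move=> t _; rewrite lee_fin gamma_fun_ge0.
- by rewrite lee_fin divr_ge0 ?(ltW b0) ?(ltW Ga0).
rewrite (@ge0_integral_scale b (EFin \o gamma_fun a))//; last 2 first.
- exact: measurable_funTS.
- by move=> t _; rewrite lee_fin gamma_fun_ge0.
rewrite GammaE// -!EFinM; congr EFin; field.
by rewrite !gt_eqF.
Qed.

End gamma.

(** * Gaussian integrals *)

Section positive_definite.
Context {R : realType}.

Definition schur k (A : 'M[R]_(1 + k)) : 'M[R]_k :=
  drsubmx A - (A 0 0)^-1 *: (dlsubmx A *m ursubmx A).

Lemma quad_schur k (A : 'M[R]_(1 + k)) (a : R) (w : 'cV[R]_k) :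
  A^T = A -> A 0 0 != 0 ->
  ((col_mx a%:M w)^T *m A *m col_mx a%:M w) 0 0 =
  A 0 0 * (a + (A 0 0)^-1 * (ursubmx A *m w) 0 0) ^+ 2 +
  (w^T *m schur A *m w) 0 0.
Proof.
move=> sA A0; set al := A 0 0.
have Aul : ulsubmx A = al%:M.
  rewrite [LHS]mx11_scalar; congr (_%:M); rewrite !mxE.
  by congr (A _ _); apply: val_inj.
have Adl : dlsubmx A = (ursubmx A)^T by rewrite trmx_ursub sA.
rewrite -{1}(submxK A) /schur Aul Adl; set B := ursubmx A; set D := drsubmx A.
rewrite tr_col_mx mul_row_block mul_row_col tr_scalar_mx.
set b := (B *m w) 0 0.
have wB : w^T *m B^T = b%:M.
  by rewrite -trmx_mul [B *m w]mx11_scalar tr_scalar_mx.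
have Bw : B *m w = b%:M by exact: mx11_scalar.
rewrite mulmxBr mulmxBl -!scalemxAr -!scalemxAl !mulmxDl -!mulmxA Bw !mulmxA wB.
set Dw := w^T *m D *m w.
rewrite -!scalar_mxM !mxE !eqxx !mulr1n -/al.
by field.
Qed.

(** One step of block elimination: [A] is a unit lower triangular block matrix times an upper
    triangular one with diagonal blocks [A 0 0] and [schur A]. *)
Lemma det_schur k (A : 'M[R]_(1 + k)) : A 0 0 != 0 ->
  \det A = A 0 0 * \det (schur A).
Proof.
move=> A0; set al := A 0 0.
have Aul : ulsubmx A = al%:M.
  rewrite [LHS]mx11_scalar; congr (_%:M); rewrite !mxE.
  by congr (A _ _); apply: val_inj.
have {1}-> : A = block_mx 1%:M 0 (al^-1 *: dlsubmx A) 1%:M *m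
              block_mx al%:M (ursubmx A) 0 (schur A).
  rewrite mulmx_block !mul1mx !mul0mx ?mulmx0 !addr0 -!scalemxAl mul_mx_scalar.
  by rewrite scalerA mulVf// scale1r /schur addrC subrK -Aul submxK.
rewrite det_mulmx det_lblock det_ublock !det1 !mul1r.
by rewrite det_scalar expr1.
Qed.

Lemma posdefmx_diag_gt0 k (A : 'M[R]_k) i : posdefmx A -> 0 < A i i.
Proof.
move=> [_ /(_ (delta_mx i 0))]; rewrite trmx_delta -rowE -colE !mxE; apply.
by apply/eqP => /matrixP /(_ i 0); rewrite !mxE !eqxx => /eqP; rewrite oner_eq0.
Qed.

Lemma posdefmx_schur k (A : 'M[R]_(1 + k)) : posdefmx A -> posdefmx (schur A).
Proof.
move=> pA; have A0 := posdefmx_diag_gt0 0 pA; have [sA posA] := pA.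
have Adl : dlsubmx A = (ursubmx A)^T by rewrite trmx_ursub sA.
split.
  rewrite /schur Adl linearB linearZ /= trmx_mul trmxK.
  by rewrite trmx_drsub sA.
(* The first coordinate that makes the square in [quad_schur] vanish, so that the form of [schur A]
   at [w] is the form of [A] at a nonzero vector. *)
move=> w w0; pose a := - ((A 0 0)^-1 * (ursubmx A *m w) 0 0).
have /posA : col_mx a%:M w != 0.
  apply: contra w0 => /eqP v0; apply/eqP.
  by rewrite -[w](col_mxKd a%:M) v0 linear0.
by rewrite quad_schur ?gt_eqF// /a addNr expr0n mulr0 add0r.
Qed.

Lemma posdefmx_det_gt0 k (A : 'M[R]_k) : posdefmx A -> 0 < \det A.
Proof.
elim: k A => [|k IH] A pA; first by rewrite det_mx00.
have A0 := @posdefmx_diag_gt0 (1 + k) A 0 pA.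
rewrite (@det_schur k A) ?gt_eqF// mulr_gt0//.
by apply/IH/posdefmx_schur.
Qed.

Lemma posdefmx_unit k (A : 'M[R]_k) : posdefmx A -> A \in unitmx.
Proof. by move=> /posdefmx_det_gt0 ?; rewrite unitmxE unitfE gt_eqF. Qed.

Lemma posdefmxZ k (A : 'M[R]_k) c : 0 < c -> posdefmx A -> posdefmx (c *: A).
Proof.
move=> c0 [sA pA]; split; first by rewrite linearZ /= sA.
by move=> v v0; rewrite -scalemxAr -scalemxAl mxE mulr_gt0// pA.
Qed.

Lemma posdefmx_ge0 k (A : 'M[R]_k) (v : 'cV[R]_k) :
  posdefmx A -> 0 <= (v^T *m A *m v) 0 0.
Proof.
move=> [_ pA]; have [->|/pA/ltW//] := eqVneq v 0.
by rewrite mulmx0 mxE.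
Qed.

End positive_definite.

(** * Gaussian densities in precision form *)

Section gaussian.
Context {R : realType}.
Local Notation mu := (@lebesgue_measure R).

Lemma sqrt_expR (y : R) : 0 < y -> Num.sqrt y = expR (2^-1 * ln y).
Proof. by move=> y0; rewrite -powR12_sqrt ?ltW// /powR gt_eqF. Qed.

Lemma normal_pdf_precisionE (c r x : R) : 0 < r ->
  normal_pdf c (Num.sqrt r^-1) x =
  expR (2^-1 * ln r - 2^-1 * ln (2 * pi) - 2^-1 * (r * (x - c) ^+ 2)).
Proof.
move=> r0; have p0 := pi_gt0 R; have r0' : 0 < r^-1 by rewrite invr_gt0.
rewrite normal_pdfE ?sqrtr_eq0 -?ltNge//.
rewrite /normal_peak /normal_fun sqr_sqrtr ?ltW//.
have -> : r^-1 * pi *+ 2 = r^-1 * (2 * pi) by rewrite -mulr_natr; ring.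
rewrite sqrt_expR ?mulr_gt0// -expRN -expRD [ln (r^-1 * _)]lnM ?posrE ?mulr_gt0//
  lnV ?posrE//.
congr expR; have -> : r^-1 *+ 2 = 2 / r by rewrite -mulr_natr; ring.
by field; rewrite gt_eqF.
Qed.

Lemma mvnormal_pdf_precisionE k (m : 'cV[R]_k) (A : 'M[R]_k) v : posdefmx A ->
  mvnormal_pdf m (invmx A) v =
  expR (2^-1 * ln (\det A) - 2^-1 * (k%:R * ln (2 * pi)) -
        2^-1 * ((v - m)^T *m A *m (v - m)) 0 0).
Proof.
move=> pA; have d0 := posdefmx_det_gt0 pA; have p0 := pi_gt0 R.
have p20 : 0 < 2 * pi :> R by rewrite mulr_gt0.
rewrite /mvnormal_pdf invmxK det_inv sqrt_expR; last first.
  by rewrite mulr_gt0 ?invr_gt0// exprn_gt0.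
rewrite -expRN -expRD lnM ?posrE ?exprn_gt0 ?invr_gt0// lnV ?posrE// lnXn//.
by congr expR; rewrite -mulr_natl; ring.
Qed.

(** Tuples carry the Lebesgue measure, column vectors the linear algebra. *)
Definition col_of_tuple k (t : k.-tuple (measurableTypeR R)) : 'cV[R]_k :=
  \col_i tnth t i.

Lemma measurable_mulmx d (T : measurableType d) p q r
    (A : T -> 'M[R]_(p, q)) (B : T -> 'M[R]_(q, r)) :
  (forall i j, measurable_fun setT (fun t => A t i j)) ->
  (forall i j, measurable_fun setT (fun t => B t i j)) ->
  forall i j, measurable_fun setT (fun t => (A t *m B t) i j).
Proof.
move=> mA mB i j; under eq_fun do rewrite mxE.
by apply: measurable_sum => l; exact: measurable_funM.
Qed.

Lemma measurable_quad d (T : measurableType d) k (A : 'M[R]_k)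
    (u : T -> 'cV[R]_k) :
  (forall i, measurable_fun setT (fun t => u t i 0)) ->
  measurable_fun setT (fun t => ((u t)^T *m A *m u t) 0 0).
Proof.
move=> mu_; apply: measurable_mulmx => [i j|i j]; last by rewrite (ord1 j).
apply: measurable_mulmx => [{}i {}j|{}i {}j]; last exact: measurable_cst.
suff -> : (fun t => (u t)^T i j) = (fun t => u t j 0) by exact: mu_.
by apply/funext => t; rewrite mxE (ord1 i).
Qed.

Lemma measurable_mvnormal_pdf k (m : 'cV[R]_k) S :
  measurable_fun setT (fun t => mvnormal_pdf m S (col_of_tuple t)).
Proof.
apply: measurable_funM => //; apply: measurableT_comp => //.
apply: measurableT_comp => //; apply: measurable_funM => //.
apply: measurable_quad => i; under eq_fun do rewrite !mxE.
by apply: measurable_funB => //; exact: measurable_tnth.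
Qed.

Lemma mvnormal_pdf_ge0 k (m : 'cV[R]_k) S v : 0 <= mvnormal_pdf m S v.
Proof. by rewrite mulr_ge0 ?expR_ge0// invr_ge0. Qed.

(* Completing the square in the first coordinate leaves a Gaussian factor
   whose precision is the Schur complement. *)
Lemma integral_mvnormal_pdf k (m : 'cV[R]_k) (A : 'M[R]_k) : posdefmx A ->
  (\int[tuple_measure mu k]_t
     (mvnormal_pdf m (invmx A) (col_of_tuple t))%:E = 1)%E.
Proof.
elim: k m A => [|k IH] m A pA.
  rewrite /= integral_dirac//=; last first.
    by apply/measurable_EFinP; exact: measurable_mvnormal_pdf.
  rewrite diracE mem_set// mul1e mvnormal_pdf_precisionE//.
  by rewrite det_mx00 ln1 mul0r !mulr0
    [X in _ * X]mxE big_ord0 mulr0 !subr0 expR0.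
have pS := @posdefmx_schur _ k A pA; have [sA _] := pA.
have A0 := @posdefmx_diag_gt0 _ (1 + k) A 0 pA.
have S0 := posdefmx_det_gt0 pS.
pose m' : 'cV[R]_k := dsubmx (m : 'cV[R]_(1 + k)).
(* The conditional mean of the first coordinate when the others equal [w]. *)
pose c (w : 'cV[R]_k) : R := m 0 0 -
  (A 0 0)^-1 * (@ursubmx _ 1 k 1 k A *m (w - m')) 0 0.
transitivity (\int[tuple_measure mu k]_t
    \int[mu]_x (mvnormal_pdf m (invmx A) (col_of_tuple (cons_pair (x, t))))%:E)%E.
  apply: (@ge0_integral_cons_measure _ _ R k mu (tuple_measure mu k)
    (fun p => (mvnormal_pdf m (invmx A) (col_of_tuple p))%:E)).
    by apply/measurable_EFinP; exact: measurable_mvnormal_pdf.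
  by move=> p; rewrite lee_fin mvnormal_pdf_ge0.
rewrite -[RHS](IH m' (schur (A : 'M[R]_(1 + k))) pS); apply: eq_integral => t _.
transitivity (\int[mu]_x
    ((mvnormal_pdf m' (invmx (schur (A : 'M[R]_(1 + k)))) (col_of_tuple t))%:E *
     (normal_pdf (c (col_of_tuple t)) (Num.sqrt (A 0 0)^-1) x)%:E))%E.
  apply: eq_integral => x _; rewrite -EFinM; congr EFin.
  rewrite normal_pdf_precisionE// !mvnormal_pdf_precisionE// -expRD.
  have -> : col_of_tuple (cons_pair (x, t)) - m =
      col_mx (x - m 0 0)%:M (col_of_tuple t - m') :> 'cV[R]_(1 + k).
    rewrite -[LHS](@vsubmxK _ 1 k 1); congr col_mx; last first.
      apply/matrixP => i j; rewrite !mxE (ord1 j).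
      by congr (_ - _); rewrite rshift1 tnthS.
    rewrite [LHS]mx11_scalar; congr _%:M; rewrite !mxE.
    have -> : @lshift 1 k 0 = ord0 by apply: val_inj.
    by rewrite tnth0.
  rewrite (@quad_schur _ k A)//; last by rewrite gt_eqF.
  rewrite (@det_schur _ k A) ?gt_eqF// lnM ?posrE// /c.
  congr expR; rewrite -[k.+1%:R]natr1; ring.
rewrite ge0_integralZl//.
- by rewrite integral_normal_pdf mule1.
- by apply/measurable_EFinP; exact: measurable_normal_pdf.
- by move=> x _; rewrite lee_fin normal_pdf_ge0.
- by rewrite lee_fin mvnormal_pdf_ge0.
Qed.

End gaussian.

(** * Completing the square in weighted least squares *)

Section quadratic_forms.
Context {R : realType}.

Lemma quadB k (A : 'M[R]_k) (u v : 'cV[R]_k) : A^T = A ->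
  ((u - v)^T *m A *m (u - v)) 0 0 =
  (u^T *m A *m u) 0 0 - 2 * (u^T *m A *m v) 0 0 + (v^T *m A *m v) 0 0.
Proof.
move=> sA; have vAu : (v^T *m A *m u) 0 0 = (u^T *m A *m v) 0 0.
  have <- : (v^T *m A *m u)^T = u^T *m A *m v.
    by rewrite !trmx_mul trmxK sA mulmxA.
  by rewrite [RHS]mxE.
have N (B C : 'M[R]_1) : (B - C) 0 0 = B 0 0 - C 0 0 by rewrite !mxE.
rewrite [(u - v)^T]linearB /= mulmxBl mulmxBr N mulmxBl N mulmxBl N vAu; ring.
Qed.

Lemma quad_diag k (d : 'rV[R]_k) (v : 'cV[R]_k) :
  (v^T *m diag_mx d *m v) 0 0 = \sum_i d 0 i * v i 0 ^+ 2.
Proof.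
rewrite mxE; apply: eq_bigr => i _; rewrite mul_mx_diag !mxE; ring.
Qed.

(** [m'] solves the normal equations [B *m m' = A *m m + X^T *m Q *m x], so both sides have the same
    quadratic and linear terms in [th]; the last summand restores the constant term. *)
Lemma complete_square n k (X : 'M[R]_(n, k)) (Q : 'M[R]_n) (A : 'M[R]_k)
    (x : 'cV[R]_n) (m th : 'cV[R]_k) :
  let B := A + X^T *m Q *m X in
  let m' := invmx B *m (A *m m + X^T *m Q *m x) in
  A^T = A -> Q^T = Q -> B \in unitmx ->
  ((th - m)^T *m A *m (th - m)) 0 0 +
    ((X *m th - x)^T *m Q *m (X *m th - x)) 0 0 =
  ((th - m')^T *m B *m (th - m')) 0 0 +
    (m^T *m A *m m + x^T *m Q *m x - m'^T *m B *m m') 0 0.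
Proof.
move=> B m' sA sQ uB.
have sB : B^T = B.
  by rewrite /B linearD /= sA !trmx_mul trmxK sQ mulmxA.
have Bm' : B *m m' = A *m m + X^T *m Q *m x.
  by rewrite /m' mulmxA mulmxV// mul1mx.
have thB : th^T *m B *m th = th^T *m A *m th + (X *m th)^T *m Q *m (X *m th).
  by rewrite /B mulmxDr mulmxDl trmx_mul !mulmxA.
have thm : th^T *m B *m m' = th^T *m A *m m + (X *m th)^T *m Q *m x.
  by rewrite -mulmxA Bm' mulmxDr trmx_mul !mulmxA.
rewrite !quadB// thB thm; set m1 := m'^T *m B *m m'.
have D (E F : 'M[R]_1) : (E + F) 0 0 = E 0 0 + F 0 0 by rewrite mxE.
have N (E F : 'M[R]_1) : (E - F) 0 0 = E 0 0 - F 0 0 by rewrite !mxE.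
rewrite N !D; ring.
Qed.

End quadratic_forms.

(** * The normal-gamma density *)

Section normal_gamma.
Context {R : realType}.
Local Notation leb := (@lebesgue_measure R).

Definition normal_gamma_pdf k (m : 'cV[R]_k) (L : 'M[R]_k) (al be : R)
    (th : 'cV[R]_k) (ta : R) : R :=
  mvnormal_pdf m (invmx (ta *: L)) th * gamma_pdf al be ta.

(** The term [k%:R * ln ta] comes from [\det (ta *: L) = ta ^+ k * \det L]. *)
Lemma normal_gamma_pdfE k (m : 'cV[R]_k) L al be th ta :
  posdefmx L -> 0 < al -> 0 < be ->
  0 < ta -> normal_gamma_pdf m L al be th ta =
  expR (2^-1 * ln (\det L) + 2^-1 * (k%:R * ln ta) -
        2^-1 * (k%:R * ln (2 * pi)) -
        2^-1 * (ta * ((th - m)^T *m L *m (th - m)) 0 0) +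
        (al * ln be - ln (Gamma al) + (al - 1) * ln ta - be * ta)).
Proof.
move=> pL al0 be0 ta0; rewrite /normal_gamma_pdf gamma_pdfE//.
rewrite mvnormal_pdf_precisionE; last exact: posdefmxZ.
rewrite -expRD detZ [ln (ta ^+ _ * _)]lnM ?posrE ?exprn_gt0 ?posdefmx_det_gt0//.
have Z (B : 'M[R]_1) : (ta *: B) 0 0 = ta * B 0 0 by rewrite mxE.
rewrite lnXn// -scalemxAr -scalemxAl Z -mulr_natl.
by congr expR; ring.
Qed.

Lemma normal_gamma_pdf_gt0 k (m : 'cV[R]_k) L al be th ta :
  posdefmx L -> 0 < al -> 0 < be ->
  0 < ta -> 0 < normal_gamma_pdf m L al be th ta.
Proof. by move=> *; rewrite normal_gamma_pdfE// expR_gt0. Qed.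

Local Notation gaussian_gamma k :=
  (k.-tuple (measurableTypeR R) * measurableTypeR R)%type.

(* [normal_gamma_pdf] is meaningful for a positive precision only. *)
Definition normal_gamma_fun k (m : 'cV[R]_k) (L : 'M[R]_k) (al be : R)
    (z : gaussian_gamma k) : R :=
  if 0 < z.2 then normal_gamma_pdf m L al be (col_of_tuple z.1) z.2 else 0.

Section normal_gamma_fun.
Context k (m : 'cV[R]_k) (L : 'M[R]_k) (al be : R).
Hypotheses (pL : posdefmx L) (al0 : 0 < al) (be0 : 0 < be).

Lemma normal_gamma_fun_ge0 z : 0 <= normal_gamma_fun m L al be z.
Proof.
rewrite /normal_gamma_fun; case: ifPn => // z0.
exact/ltW/normal_gamma_pdf_gt0.
Qed.

Lemma measurable_normal_gamma_fun :
  measurable_fun setT (normal_gamma_fun m L al be).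
Proof.
(* In this form no determinant or inverse depends on the precision, so measurability is checked term
   by term. *)
pose f (z : gaussian_gamma k) : R := expR
  (2^-1 * ln (\det L) + 2^-1 * (k%:R * ln z.2) - 2^-1 * (k%:R * ln (2 * pi)) -
   2^-1 * (z.2 * ((col_of_tuple z.1 - m)^T *m L *m (col_of_tuple z.1 - m)) 0 0) +
   (al * ln be - ln (Gamma al) + (al - 1) * ln z.2 - be * z.2)).
have -> : normal_gamma_fun m L al be = fun z => if 0 < z.2 then f z else 0.
  apply/funext => z; rewrite /normal_gamma_fun; case: ifPn => // z0.
  by rewrite normal_gamma_pdfE.
have m2 : measurable_fun [set: gaussian_gamma k] (fun z => z.2 : R).
  exact: measurable_snd.
have ml : measurable_fun [set: gaussian_gamma k] (fun z => ln z.2 : R).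
  by apply: measurableT_comp m2; exact: measurable_ln.
have mq : measurable_fun [set: gaussian_gamma k] (fun z : gaussian_gamma k =>
    ((col_of_tuple z.1 - m)^T *m L *m (col_of_tuple z.1 - m)) 0 0).
  apply: measurable_quad => i; under eq_fun do rewrite !mxE.
  apply: measurable_funB => //.
  apply: (measurableT_comp (measurable_tnth i)); exact: measurable_fst.
apply: measurable_fun_ifT => //; first exact: measurable_fun_ltr.
apply: measurableT_comp => //; apply: measurable_funD.
  apply: measurable_funB.
    apply: measurable_funB => //; apply: measurable_funD => //.
    by apply: measurable_funM => //; exact: measurable_funM.
  by apply: measurable_funM => //; exact: measurable_funM.
apply: measurable_funB; last exact: measurable_funM.
by apply: measurable_funD => //; exact: measurable_funM.
Qed.

Lemma integral_normal_gamma_fun :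
  (\int[product_measure (tuple_measure leb k) leb]_z
     (normal_gamma_fun m L al be z)%:E = 1)%E.
Proof.
rewrite (@ge0_integral_product_measure _ _ _ _ R (tuple_measure leb k) leb
  (fun z => (normal_gamma_fun m L al be z)%:E)); last 2 first.
- by apply/measurable_EFinP; exact: measurable_normal_gamma_fun.
- by move=> z; rewrite lee_fin normal_gamma_fun_ge0.
(* For a fixed precision the Gaussian factor integrates to 1; the gamma density on the positive
   half-line remains. *)
rewrite -(integral_gamma_pdf al0 be0) [RHS]integral_mkcond.
apply: eq_integral => ta _; rewrite /patch mem_setE in_itv/= andbT.
case: ifPn => [ta0|/negPf ta0]; last first.
  by apply: integral0_eq => t _; rewrite /normal_gamma_fun /= ta0.
transitivity (\int[tuple_measure leb k]_t ((gamma_pdf al be ta)%:E *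
    (mvnormal_pdf m (invmx (ta *: L)) (col_of_tuple t))%:E))%E.
  apply: eq_integral => t _; rewrite /normal_gamma_fun /= ta0.
  by rewrite /normal_gamma_pdf EFinM muleC.
rewrite ge0_integralZl//.
- by rewrite integral_mvnormal_pdf ?mule1//; exact: posdefmxZ.
- by apply/measurable_EFinP; exact: measurable_mvnormal_pdf.
- by move=> t _; rewrite lee_fin mvnormal_pdf_ge0.
- by rewrite lee_fin gamma_pdf_ge0.
Qed.

End normal_gamma_fun.

End normal_gamma.

(** * Normal-gamma densities on the parameter space of a tree *)

Section parameter_space.
Context {R : realType} {M D K : nat} (T : tree M D).
Context (m : node M D -> 'cV[R]_K.+1) (L : node M D -> 'M[R]_K.+1).
Context (al be : node M D -> R).
Hypotheses (pL : forall s, posdefmx (L s)) (al0 : forall s, 0 < al s)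
  (be0 : forall s, 0 < be s).

Definition leaves_density (p : param R K T) : R :=
  \prod_(s : leaf T)
    normal_gamma_pdf (m (val s)) (L (val s)) (al (val s)) (be (val s))
      (theta p s) (tau p s).

Let h (i : 'I_#|{: leaf T}|) :=
  normal_gamma_fun (m (val (enum_val i))) (L (val (enum_val i)))
    (al (val (enum_val i))) (be (val (enum_val i))).

(** Extension by zero factors over the coordinates: outside [param_dom] some precision is not
    positive, and its factor vanishes. *)
Let leaves_density_patch (p : param R K T) :
  (if `[< param_dom p >] then leaves_density p else 0) =
  \prod_(i < #|{: leaf T}|) h i (tnth p i).
Proof.
rewrite (reindex (@enum_rank (leaf T))); last exact/onW_bij/enum_rank_bij.
case: asboolP => [dp|ndp].
  apply: eq_bigr => s _; rewrite /h enum_rankK /normal_gamma_fun.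
  by have := dp s; rewrite /tau => ->.
have [s] : exists s : leaf T, ~ 0 < tau p s by apply/existsNP.
move=> /negP/negPf s0; rewrite (bigD1 s)//= /h enum_rankK /normal_gamma_fun.
by move: s0; rewrite /tau => ->; rewrite mul0r.
Qed.

Let measurable_h : measurable_fun setT
  (fun p : param R K T => \prod_(i < #|{: leaf T}|) h i (tnth p i)).
Proof.
apply: measurable_prod => i _ /=.
apply: (measurableT_comp (measurable_normal_gamma_fun _ (pL _) (al0 _) (be0 _))).
exact: measurable_tnth.
Qed.

Lemma measurable_leaves_density :
  measurable_fun (@param_dom M D R K T) leaves_density.
Proof.
apply: eq_measurable_fun (measurable_funTS measurable_h) => p.
by rewrite inE => dp; rewrite -leaves_density_patch asboolT.
Qed.

Lemma leaves_density_gt0 (p : param R K T) : param_dom p -> 0 < leaves_density p.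
Proof.
by move=> dp; apply: prodr_gt0 => s _; apply: normal_gamma_pdf_gt0.
Qed.

Lemma integral_leaves_density c : 0 <= c ->
  (\int[param_lebesgue R K T]_(p in @param_dom M D R K T)
     (c * leaves_density p)%:E = c%:E)%E.
Proof.
move=> c0; rewrite integral_mkcond.
transitivity (\int[param_lebesgue R K T]_p
    (c%:E * (\prod_(i < #|{: leaf T}|) h i (tnth p i))%:E))%E.
  apply: eq_integral => p _; rewrite -leaves_density_patch /patch.
  by case: asboolP => dp; [rewrite mem_set// EFinM|rewrite memNset// mule0].
rewrite ge0_integralZl//; last 2 first.
- by apply/measurable_EFinP; exact: measurable_h.
- by move=> p _; rewrite lee_fin prodr_ge0// => i _; exact: normal_gamma_fun_ge0.
rewrite -[RHS]mule1; congr (_ * _)%E.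
apply: etrans (@ge0_integral_tuple_measure _ _ R _ _ h _ _) _ => [i|i z|].
- exact: measurable_normal_gamma_fun.
- exact: normal_gamma_fun_ge0.
- by apply: big1 => i _; exact: integral_normal_gamma_fun.
Qed.

End parameter_space.

(** * Trees *)

Section nodes.
Local Open Scope set_scope.
Context {M D : nat}.
Implicit Types (s : node M D) (T : tree M D).

Lemma val_child s m : inner s -> child s m = rcons s m :> seq 'I_M.
Proof. by move=> si; rewrite /child /insub_bseq val_insubd size_rcons ifT. Qed.

Lemma child_inj s1 s2 m1 m2 : inner s1 -> inner s2 ->
  child s1 m1 = child s2 m2 -> s1 = s2 /\ m1 = m2.
Proof.
move=> i1 i2 /(congr1 val); rewrite /= !val_child// => /rcons_inj[e ->].
by split=> //; apply: val_inj.
Qed.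

Lemma nodeP s : s = root_node \/ exists s' m, inner s' /\ s = child s' m.
Proof.
have sD := size_bseq s; case/lastP E : (val s) => [|r m].
  by left; apply: val_inj.
right; have rD : (size r < D)%N by rewrite -(size_rcons r m) -E.
exists (insub_bseq D r), m; have rE : val (insub_bseq D r) = r.
  by rewrite /insub_bseq val_insubd ltnW.
have ri : inner (insub_bseq D r) by rewrite /inner [size _](congr1 size rE).
by split=> //; apply: val_inj; rewrite E /= val_child// rE.
Qed.

Lemma prec_child s s' m : inner s ->
  prec s' (child s m) = (s' == child s m) || prec s' s.
Proof.
move=> si; rewrite /prec -val_eqE /= val_child//.
elim: {s si} (val s) (val s') => [|x u IH] [|y v] //=.
  by rewrite eqseq_cons; case: v => [|z v] /=; rewrite ?andbT ?andbF ?orbF.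
by rewrite eqseq_cons IH; case: (y == x).
Qed.

Lemma prec_size s s' : prec s s' -> (size s <= size s')%N.
Proof. exact: size_prefix. Qed.

Lemma prec_refl s : prec s s.
Proof. exact: prefix_refl. Qed.

Lemma prec_trans : transitive (@prec M D).
Proof. by move=> s2 s1 s3; exact: prefix_trans. Qed.

Lemma prec_eq s s' : prec s s' -> (size s' <= size s)%N -> s = s'.
Proof.
rewrite /prec prefixE => /eqP e h; apply: val_inj.
by rewrite /= -e take_oversize.
Qed.

Lemma prec_child_self s m : inner s -> prec s (child s m).
Proof. by move=> si; rewrite prec_child// prec_refl orbT. Qed.

Lemma prec_childN s m : inner s -> prec (child s m) s = false.
Proof.
move=> si; apply/negP => /prec_size.
by rewrite [size (child s m)](congr1 size (val_child m si)) size_rcons ltnn.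
Qed.

Lemma tree_root T : root_node \in val T.
Proof. by have /and3P[] := valP T. Qed.

Lemma tree_prec T s s' : s \in val T -> prec s' s -> s' \in val T.
Proof.
have /and3P[_ /forall_inP h _] := valP T.
by move=> /h /forallP /(_ s') /implyP.
Qed.

Lemma innersP T s : reflect
  [/\ s \in val T, inner s & exists m, child s m \in val T] (s \in inners T).
Proof.
rewrite inE; apply: (iffP and3P) => -[sT si].
  by move=> /existsP.
by move=> h; split=> //; apply/existsP.
Qed.

Lemma inners_child T s m : s \in inners T -> child s m \in val T.
Proof.
move=> /innersP[sT si [m' m'T]].
have /and3P[_ _ /forall_inP/(_ s sT)] := valP T.
rewrite si /= => /orP[/forallP//|/forallP/(_ m')].
by rewrite m'T.
Qed.

Lemma inners_inner T s : s \in inners T -> inner s.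
Proof. by case/innersP. Qed.

Lemma inners_sub T : inners T \subset val T.
Proof. by apply/fintype.subsetP => s /innersP[]. Qed.

Lemma child_inners T s m : inner s -> child s m \in val T -> s \in inners T.
Proof.
move=> si cT; apply/innersP; split => //; last by exists m.
exact: tree_prec cT (prec_child_self m si).
Qed.

(** * Products over the nodes of a tree *)

Section products.
Context {R : comPzRingType}.

Lemma prod_tree T (F : node M D -> R) :
  \prod_(s in val T) F s =
  (\prod_(s in inners T) F s) * \prod_(s in leaves T) F s.
Proof.
rewrite (finset.big_setID (inners T)) /leaves; congr (_ * _).
by apply: eq_bigl => s; rewrite (finset.setIidPr (inners_sub T)).
Qed.

(** Every node of [T] but the root is a child of exactly one inner node of [T]. Compared with
    [prod_tree], this is what makes products of [phi] telescope. *)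
Lemma prod_tree_children T (F : node M D -> R) :
  \prod_(s in val T) F s =
  F root_node * \prod_(s in inners T) \prod_(m < M) F (child s m).
Proof.
rewrite (finset.big_setD1 root_node (tree_root T)); congr (_ * _).
have -> : val T :\ root_node =
    [set child p.1 p.2 | p in finset.setX (inners T) [set: 'I_M]].
  apply/setP => s; rewrite finset.in_setD1; apply/andP/imsetP => [[sr sT]|].
    have [/eqP|[s' [m [s'i sE]]]] := nodeP s; first by rewrite (negPf sr).
    exists (s', m) => //; rewrite finset.in_setX /= finset.in_setT andbT.
    by apply: (child_inners (m := m)) => //; rewrite -sE.
  move=> [[s' m]]; rewrite finset.in_setX /= => /andP[s'I _] ->; split.
    apply/eqP => /(congr1 (fun s : node M D => val s)).
    by rewrite /= (val_child _ (inners_inner s'I)); case: (val s').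
  exact: inners_child.
rewrite big_imset /=; last first.
  move=> [s1 m1] [s2 m2]; rewrite !finset.in_setX /= => /andP[i1 _] /andP[i2 _].
  by move=> /(child_inj (inners_inner i1) (inners_inner i2))[-> ->].
by rewrite pair_big /=; apply: eq_bigl => -[s m]; rewrite finset.in_setX /= finset.in_setT.
Qed.

End products.

(** * Trees grown by independent splitting *)

Section random_tree.
Variable f : {ffun node M D -> bool}.

(** The tree grown from one outcome [f] of coin flips at all nodes; whether a node is reached
    depends only on the flips at its proper ancestors. *)
Definition splitting_set : {set node M D} :=
  [set s | [forall s', prec s' s ==> ((s' == s) || f s')]].

Lemma splitting_setP s : reflect (forall s', prec s' s -> s' != s -> f s')
  (s \in splitting_set).
Proof.
rewrite inE; apply: (iffP forallP) => h s'.
  by move=> ps /negPf n; have := h s'; rewrite ps n.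
by apply/implyP => ps; case: eqVneq => //= n; exact: h.
Qed.

Lemma splitting_set_child s m : inner s ->
  (child s m \in splitting_set) = (s \in splitting_set) && f s.
Proof.
move=> si; have cs := prec_childN m si.
have sc : s != child s m by apply: contraFneq cs => <-; exact: prec_refl.
apply/splitting_setP/andP => [h|[/splitting_setP h fs] s'].
  split; last by apply: h => //; exact: prec_child_self.
  apply/splitting_setP => s' ps n; apply: h.
    by rewrite prec_child// ps orbT.
  by apply: contraTneq ps => ->; rewrite cs.
rewrite prec_child// => /orP[/eqP->|ps _]; first by rewrite eqxx.
by have [->//|] := eqVneq s' s; exact: h.
Qed.

Lemma splitting_set_regular : regular_subtree splitting_set.
Proof.
apply/and3P; split.
- apply/splitting_setP => s'; rewrite /prec prefixs0 => /eqP s0 /eqP[].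
  exact: val_inj.
- apply/forall_inP => s /splitting_setP h; apply/forallP => s'; apply/implyP.
  move=> ps; apply/splitting_setP => r pr rs'; apply: h.
    exact: prec_trans pr ps.
  by apply: contra rs' => /eqP rs; rewrite (prec_eq pr)// rs prec_size.
- apply/forall_inP => s sS; apply/implyP => si; case fs: (f s).
    by apply/orP; left; apply/forallP => m; rewrite splitting_set_child// sS fs.
  by apply/orP; right; apply/forallP => m; rewrite splitting_set_child// fs andbF.
Qed.

Definition splitting_tree : tree M D := Sub splitting_set splitting_set_regular.

End random_tree.

(** The condition under which the flip [b] at [s] agrees with [T]. Flips outside [T] and at maximal
    depth are free. A condition node by node lets a sum over all compatible [f] factor over the
    nodes. *)
Definition compatible T s (b : bool) : bool :=
  if s \in inners T then b else (s \in leaves T) && inner s ==> ~~ b.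

(** Membership of a node is decided by its parent and the flip there, so the two trees are compared
    by induction on depth. *)
Lemma compatibleP T (f : {ffun node M D -> bool}) : (0 < M)%N ->
  (f \in family (compatible T)) = (T == splitting_tree f).
Proof.
move=> M0; apply/familyP/eqP => [h|-> s]; last first.
  rewrite unfold_in /compatible; case: ifPn => [sI|sI].
    have /innersP[_ si [m]] := sI.
    by rewrite /= splitting_set_child// => /andP[].
  apply/implyP; rewrite finset.in_setD => /andP[/andP[_ sT] si].
  apply: contra sI => fs; apply/innersP; split=> //.
  (* A node counts as inner only through an actual child, which [0 < M] supplies. *)
  by exists (Ordinal M0); rewrite /= splitting_set_child//; apply/andP.
apply: val_inj; apply/setP => s /=.
have [k] := ubnP (size s); elim: k s => // k IH s.
have [->|[s' [m [s'i ->]]] sk] := nodeP s.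
  by rewrite tree_root (tree_root (splitting_tree f)).
rewrite splitting_set_child// -IH; last first.
  by move: sk; rewrite [size (child s' m)](congr1 size (val_child m s'i))
    size_rcons ltnS.
apply/idP/andP => [cT|[s'T fs']].
  have s'I := child_inners s'i cT; split; first by case/innersP: s'I.
  by have := h s'; rewrite unfold_in /compatible s'I.
apply: inners_child; apply: contraTT fs' => s'I.
have := h s'; rewrite unfold_in /compatible (negPf s'I).
by rewrite finset.in_setD s'I s'T s'i.
Qed.

(* Split every inner node [s] independently with probability [g s]: the
   summand at [T] is the probability that the resulting tree is [T]. *)
Lemma sum_tree_prob (R : comPzRingType) (g : node M D -> R) : (0 < M)%N ->
  (forall s, ~~ inner s -> g s = 0%R) ->
  \sum_(T : tree M D)
    ((\prod_(s in inners T) g s) * \prod_(s in leaves T) (1 - g s)) = 1.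
Proof.
move=> M0 g0; pose w s (b : bool) := if b then g s else 1 - g s.
(* The weight of [T] is the total weight of the flips compatible with it, because each free flip
   sums to 1. *)
transitivity (\sum_(T : tree M D) \sum_(f in family (compatible T))
    \prod_s w s (f s)).
  apply: eq_bigr => T _; rewrite -bigA_distr_big_dep big_mkcond.
  rewrite [X in _ * X = _]big_mkcond -big_split /=; apply: eq_bigr => s _.
  rewrite [RHS]big_mkcond [RHS]big_bool /compatible; case: ifPn => [sI|sI] /=.
    by rewrite finset.in_setD sI mulr1 addr0.
  rewrite mul1r andbC; case: (boolP (s \in leaves T)) => sL; last first.
    by rewrite andbF /= addrC subrK.
  case: (boolP (inner s)) => si /=; first by rewrite add0r.
  (* At maximal depth the flip is free; [g s = 0] reconciles its total 1 with the factor
     [1 - g s]. *)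
  by rewrite g0// subr0 add0r.
(* After the exchange each [f] is counted once, for the only tree compatible with it. *)
rewrite (exchange_big_dep predT)//=.
under eq_bigr => f _.
  rewrite (eq_bigl (pred1 (splitting_tree f))); last first.
    by move=> T; rewrite compatibleP.
  rewrite big_pred1_eq; over.
rewrite -bigA_distr_bigA big1// => s _.
by rewrite big_bool /= addrC subrK.
Qed.

End nodes.

(** * Contexts *)

Section contexts.
Context {M D : nat}.
Implicit Types (s : node M D) (U : context M D).
Local Open Scope set_scope.

Lemma context_rowP U (d : 'I_D) : {m | val U d =1 pred1 m}.
Proof.
have /forallP/(_ d)/eqP/mem_card1[m mE] := valP U.
exists m => m'; rewrite -[RHS](mE m') unfold_in /in_set /=.
by rewrite asboolb.
Qed.

Definition context_row U d : 'I_M := sval (context_rowP U d).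

Lemma context_rowE U d m : val U d m = (m == context_row U d).
Proof. by rewrite (svalP (context_rowP U d) m). Qed.

Lemma val_context_leaf U :
  context_leaf U = [seq context_row U d | d <- enum 'I_D] :> seq 'I_M.
Proof.
have E : pmap (fun d => [pick m | val U d m]) (enum 'I_D) =
         [seq context_row U d | d <- enum 'I_D].
  elim: (enum 'I_D) => //= d r <-; case: pickP => [m|/(_ (context_row U d))].
    by rewrite context_rowE => /eqP ->.
  by rewrite context_rowE eqxx.
by rewrite /context_leaf E /insub_bseq val_insubd size_map size_enum_ord leqnn.
Qed.

Lemma size_context_leaf U : size (context_leaf U) = D.
Proof. by rewrite val_context_leaf size_map size_enum_ord. Qed.

Lemma context_leaf_inj : injective (@context_leaf M D).
Proof.
move=> U V /(congr1 (fun s : node M D => val s)).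
rewrite /= !val_context_leaf => /eq_in_map e.
apply/val_inj/matrixP => d m; rewrite !context_rowE e//.
by rewrite mem_enum.
Qed.

(** Together with [context_leaf_inj], identifies contexts with the nodes of maximal depth. *)
Lemma context_leaf_surj s : (0 < M)%N -> ~~ inner s ->
  exists U, context_leaf U = s.
Proof.
move=> M0; rewrite /inner -leqNgt => Ds; have sD : size s = D.
  by apply/eqP; rewrite eqn_leq size_bseq.
pose m0 := Ordinal M0; pose V : 'M[bool]_(D, M) := \matrix_(d, m) (m == nth m0 s d).
have VP : [forall d, #|[set m | V d m]%classic| == 1%N].
  apply/forallP => d; apply/eqP; rewrite -(card1 (nth m0 s d)).
  by apply: eq_card => m; rewrite unfold_in /in_set /= mxE asboolb.
pose U : context M D := Sub V VP.
exists U; apply: val_inj; rewrite /= val_context_leaf.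
rewrite (_ : map _ _ = map (nth m0 s \o val) (enum 'I_D)); last first.
  apply: eq_map.
  move=> d; apply/esym/eqP; rewrite -context_rowE /= mxE; exact: eqxx.
by rewrite map_comp val_enum_ord map_nth_iota0 ?sD// take_oversize ?sD.
Qed.

Lemma prec_context_leaf s U : ~~ inner s ->
  prec s (context_leaf U) = (context_leaf U == s).
Proof.
rewrite /inner -leqNgt => Ds; apply/idP/eqP => [ps|->]; last exact: prec_refl.
by apply/esym/prec_eq => //; rewrite size_context_leaf.
Qed.

Lemma prec_context_leaf_inner (m0 : 'I_M) s U m : inner s ->
  prec (child s m) (context_leaf U) =
  prec s (context_leaf U) && (nth m0 (context_leaf U) (size s) == m).
Proof.
move=> si; rewrite /prec (val_child m si) /=.
have : (size s < size (context_leaf U))%N by rewrite size_context_leaf.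
elim: (s : seq _) (context_leaf U : seq _) => [|x u IH] [|y v] //=.
  by rewrite prefix0s andbT eq_sym.
by rewrite ltnS => /IH ->; rewrite andbA.
Qed.

End contexts.

(** * Path probabilities under the distribution of the contexts *)

Section context_distribution.
Context {R : realType} {M D n : nat} (pi' : 'I_n -> node M D -> 'I_M -> R).
Hypothesis M0 : (0 < M)%N.
Hypothesis pi'_sum : forall t s, inner s -> \sum_(m < M) pi' t s m = 1.

Lemma q_nodeE s t : q_node pi' s t =
  \prod_(p : node M D * 'I_M | inner p.1 && prec (child p.1 p.2) s) pi' t p.1 p.2.
Proof. by rewrite /q_node pair_big_dep. Qed.

(** Passing to the child adds the single edge [(s, m)] to the path. *)
Lemma q_node_child s m t : inner s ->
  q_node pi' (child s m) t = pi' t s m * q_node pi' s t.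
Proof.
move=> si; rewrite !q_nodeE (bigD1 (s, m)) /=; last by rewrite si prec_refl.
congr (_ * _); apply: eq_bigl => -[s' m'] /=; case: (boolP (inner s')) => //= s'i.
rewrite prec_child//; case: (eqVneq (s', m') (s, m)) => [[-> ->]|ne].
  by rewrite andbF prec_childN.
rewrite andbT; case: eqP => //= /(child_inj s'i si)[e1 e2].
by rewrite e1 e2 eqxx in ne.
Qed.

Lemma q_contextE t (U : context M D) :
  q_context pi' t U = q_node pi' (context_leaf U) t.
Proof.
apply: eq_bigr => s si; rewrite [RHS]big_mkcond; apply: eq_bigr => m _.
by case: prec.
Qed.

(** Induction on the height of [s]. At maximal depth exactly one context ends at [s]; at an inner
    node the contexts are sorted by the child they visit, and the weights [pi' t s] sum to 1. *)
Lemma sum_q_context_prec t s :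
  \sum_(U : context M D | prec s (context_leaf U)) q_context pi' t U =
  q_node pi' s t.
Proof.
have [k] := ubnP (D - size s); elim: k s => // k IH s sk.
case: (boolP (inner s)) => si; last first.
  have [U0 U0E] := context_leaf_surj M0 si.
  rewrite (eq_bigl (pred1 U0)) ?big_pred1_eq ?q_contextE ?U0E// => U.
  by rewrite prec_context_leaf// -U0E (inj_eq context_leaf_inj).
pose m0 := Ordinal M0.
rewrite (partition_big (fun U => nth m0 (context_leaf U) (size s)) predT) //=.
transitivity (\sum_(m < M) q_node pi' (child s m) t).
  apply: eq_bigr => m _; rewrite -IH.
    by apply: eq_bigl => U; rewrite (prec_context_leaf_inner m0).
  rewrite [size (child s m)](congr1 size (val_child m si)) size_rcons.
  by rewrite subnS prednK ?subn_gt0.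
under eq_bigr do rewrite q_node_child//.
by rewrite -mulr_suml pi'_sum// mul1r.
Qed.

Lemma q_node_root t : q_node pi' root_node t = 1.
Proof.
rewrite q_nodeE big_pred0// => -[s m] /=; case: (boolP (inner s)) => //= si.
by apply/negP => /prec_size; rewrite [size (child s m)](congr1 size (val_child m si))
  size_rcons.
Qed.

Lemma sum_q_context t : \sum_(U : context M D) q_context pi' t U = 1.
Proof.
rewrite -(q_node_root t) -sum_q_context_prec; apply: eq_bigl => U.
by rewrite /prec prefix0s.
Qed.

(** Factors 1 inserted at the other times give the summand product form; the sum then distributes
    and each of those times contributes 1. *)
Lemma sum_q_contexts_marginal t (f : context M D -> R) :
  \sum_(U : {ffun 'I_n -> context M D}) q_contexts pi' U * f (U t) =
  \sum_(u : context M D) q_context pi' t u * f u.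
Proof.
transitivity (\sum_(U : {ffun 'I_n -> context M D}) \prod_(r < n)
    (q_context pi' r (U r) * (if r == t then f (U r) else 1))).
  apply: eq_bigr => U _; rewrite big_split /= -/(q_contexts pi' U); congr (_ * _).
  by rewrite -big_mkcond big_pred1_eq.
rewrite -(bigA_distr_bigA
  (fun r u => q_context pi' r u * (if r == t then f u else 1))).
rewrite (bigD1 t) //= [X in _ * X]big1 ?mulr1.
  by under eq_bigr do rewrite eqxx.
move=> r /negPf rt; rewrite rt; under eq_bigr do rewrite mulr1.
exact: sum_q_context.
Qed.

Lemma sum_q_contexts : 
  \sum_(U : {ffun 'I_n -> context M D}) q_contexts pi' U = 1.
Proof.
rewrite -(bigA_distr_bigA (q_context pi')) big1// => t _.
exact: sum_q_context.
Qed.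

Hypothesis pi'_ge0 : forall t s m, inner s -> 0 <= pi' t s m.

Lemma q_node_ge0 s t : 0 <= q_node pi' s t.
Proof. by rewrite q_nodeE prodr_ge0// => -[s' m] /andP[/pi'_ge0]. Qed.

Lemma q_contexts_ge0 U : 0 <= q_contexts pi' U.
Proof. by apply: prodr_ge0 => t _; rewrite q_contextE q_node_ge0. Qed.

End context_distribution.

(** * Posterior *)

Section posterior.
Context {R : realType} {M D J K n h : nat}.
Context (x0 : 'cV[R]_h) (x : 'cV[R]_n).
Context (pi' : 'I_n -> node M D -> 'I_M -> R).
Context (g : node M D -> R) (mu : 'cV[R]_K.+1) (Lam : 'M[R]_K.+1) (a b : R).
Hypothesis M0 : (0 < M)%N.
Hypothesis pi'_ge0 : forall t s m, inner s -> 0 <= pi' t s m.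
Hypothesis pi'_sum : forall t s, inner s -> \sum_(m < M) pi' t s m = 1.
Hypothesis Lam_posdef : posdefmx Lam.
Hypotheses (a0 : 0 < a) (b0 : 0 < b).
Implicit Types (s : node M D) (T : tree M D).

Local Notation Lam' := (post_Lam x0 x pi' Lam).
Local Notation mu' := (post_mu x0 x pi' mu Lam).
Local Notation a' := (post_a pi' a).
Local Notation b' := (post_b x0 x pi' mu Lam b).
Local Notation ev := (evidence x0 x pi' mu Lam a b).
Local Notation ph := (phi x0 x pi' g mu Lam a b).
Local Notation g' := (post_g x0 x pi' g mu Lam a b).

Let quad_Q s (v : 'cV[R]_n) :
  (v^T *m Qmx pi' s *m v) 0 0 = \sum_t q_node pi' s t * v t 0 ^+ 2.
Proof. by rewrite quad_diag; apply: eq_bigr => t _; rewrite mxE. Qed.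

Let quad_Q_ge0 s (v : 'cV[R]_n) : 0 <= (v^T *m Qmx pi' s *m v) 0 0.
Proof.
by rewrite quad_Q sumr_ge0// => t _; rewrite mulr_ge0 ?sqr_ge0 ?q_node_ge0.
Qed.

Lemma post_Lam_posdef s : posdefmx (Lam' s).
Proof.
have [sL pL] := Lam_posdef; split.
  by rewrite /post_Lam linearD /= sL !trmx_mul trmxK tr_diag_mx mulmxA.
move=> v v0; rewrite /post_Lam mulmxDr mulmxDl mxE ltr_wpDr ?pL//.
have -> : v^T *m ((design x0 x K)^T *m Qmx pi' s *m design x0 x K) *m v =
  (design x0 x K *m v)^T *m Qmx pi' s *m (design x0 x K *m v).
  by rewrite trmx_mul !mulmxA.
exact: quad_Q_ge0.
Qed.

(** An instance of [complete_square] with weights [q_node pi' s]; [b'] is defined so that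
    [2 * (b' s - b)] is the remainder independent of [th]. *)
Lemma quad_posterior s (th : 'cV[R]_K.+1) :
  ((th - mu)^T *m Lam *m (th - mu)) 0 0 +
    \sum_t q_node pi' s t * (x t 0 - ((regressor x0 x K t)^T *m th) 0 0) ^+ 2 =
  ((th - mu' s)^T *m Lam' s *m (th - mu' s)) 0 0 + 2 * (b' s - b).
Proof.
have [sL _] := Lam_posdef.
have bE z : 2 * (b + 2^-1 * z - b) = z by field.
rewrite [b' s]/(b + _) bE.
apply: etrans (@complete_square R _ _ (design x0 x K) (Qmx pi' s) Lam x mu th sL
  (tr_diag_mx _) (posdefmx_unit (post_Lam_posdef s))).
congr (_ + _); rewrite quad_Q; apply: eq_bigr => t _; congr (_ * _).
rewrite -sqrrN opprB; congr (_ ^+ 2); rewrite !mxE; congr (_ - _).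
by apply: eq_bigr => i _; rewrite !mxE.
Qed.

(** At [th = mu' s] the posterior form in [quad_posterior] vanishes, which exhibits [2 * (b' s - b)]
    as a sum of nonnegative terms. *)
Lemma post_b_ge s : b <= b' s.
Proof.
rewrite -subr_ge0 -(pmulr_rge0 _ (ltr0n _ 2)).
have := quad_posterior s (mu' s); rewrite subrr mulmx0 [X in _ = X + _]mxE add0r => <-.
rewrite addr_ge0 ?posdefmx_ge0// sumr_ge0// => t _.
by rewrite mulr_ge0 ?sqr_ge0 ?q_node_ge0.
Qed.

Lemma post_b_gt0 s : 0 < b' s.
Proof. exact: lt_le_trans (post_b_ge s). Qed.

Lemma trace_Qmx s : \tr (Qmx pi' s) = \sum_t q_node pi' s t.
Proof. by rewrite mxtrace_diag; apply: eq_bigr => t _; rewrite mxE. Qed.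

Lemma post_a_gt0 s : 0 < a' s.
Proof.
rewrite /post_a trace_Qmx ltr_wpDr// mulr_ge0 ?invr_ge0// sumr_ge0// => t _.
by rewrite q_node_ge0.
Qed.

(** [ev s] is the normalizing factor of the prior divided by that of the posterior, times the power
    [- \tr (Qmx pi' s) / 2] of [2 * pi] left by the weighted likelihood. *)
Lemma normal_gamma_conjugate s th ta : 0 < ta ->
  normal_gamma_pdf mu Lam a b th ta *
  expR (\sum_t q_node pi' s t *
    ln (normal_pdf (((regressor x0 x K t)^T *m th) 0 0) (Num.sqrt ta^-1) (x t 0))) =
  ev s * normal_gamma_pdf (mu' s) (Lam' s) (a' s) (b' s) th ta.
Proof.
move=> ta0; rewrite !normal_gamma_pdfE ?post_a_gt0 ?post_b_gt0//; last first.
  exact: post_Lam_posdef.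
have -> : \sum_t q_node pi' s t *
    ln (normal_pdf (((regressor x0 x K t)^T *m th) 0 0) (Num.sqrt ta^-1) (x t 0)) =
  (2^-1 * ln ta - 2^-1 * ln (2 * pi)) * \tr (Qmx pi' s) -
  2^-1 * ta * \sum_t q_node pi' s t *
    (x t 0 - ((regressor x0 x K t)^T *m th) 0 0) ^+ 2.
  rewrite trace_Qmx !mulr_sumr -sumrB; apply: eq_bigr => t _.
  by rewrite normal_pdf_precisionE// expRK; ring.
have -> := canRL (addKr _) (quad_posterior s th).
rewrite /evidence -!expRD -/Lam' -/(a' _) -/(b' _).
have -> : a' s = a + 2^-1 * \tr (Qmx pi' s) by [].
congr expR.
(* With logarithms, trace and quadratic forms turned into atoms, a polynomial identity remains. *)
move: (ln (\det Lam)) (ln ta) (ln (2 * pi)) (ln b) (ln (Gamma a)) (\tr _).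
move: (((th - mu)^T *m _ *m _) 0 0) (((th - mu' s)^T *m _ *m _) 0 0) (b' s).
move=> q q' be l1 l2 l3 l4 l5 tr; move: (ln (\det _)) (ln be) (ln (Gamma _)).
by move=> l6 l7 l8; field.
Qed.

Lemma evidence_gt0 s : 0 < ev s. Proof. exact: expR_gt0. Qed.

(** * Posterior law of the tree *)

Hypothesis g01 : forall s, 0 <= g s <= 1.
Hypothesis g_leaf : forall s, ~~ inner s -> g s = 0.

(** Legitimizes the division by [phi] in [post_g]. Induction on the height of [s]. *)
Lemma phi_gt0 s : 0 < ph s.
Proof.
have [k] := ubnP (D - size s); elim: k s => // k IH s sk.
rewrite phiE; case: ifPn => [si|_]; last exact: evidence_gt0.
have P0 : 0 < \prod_(m < M) ph (child s m).
  apply: prodr_gt0 => m _; apply: IH.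
  rewrite [size (child s m)](congr1 size (val_child m si)) size_rcons.
  by rewrite subnS prednK ?subn_gt0.
have /andP[g0 g1] := g01 s; have := evidence_gt0 s; move=> e0.
(* For [g s = 0] the evidence term survives; otherwise the product over the children is positive,
   even if [g s = 1]. *)
have [->|gN0] := eqVneq (g s) 0; first by rewrite subr0 mul1r mul0r addr0.
by rewrite ltr_wpDl ?mulr_ge0 ?subr_ge0 ?(ltW e0)// mulr_gt0// lt_def gN0.
Qed.

Definition tree_weight T : R := prior_tree g T * \prod_(s in leaves T) ev s.

Definition post_tree T : R :=
  (\prod_(s in inners T) g' s) * \prod_(s in leaves T) (1 - g' s).

(** Multiplying by [ph s] turns [g' s] into [g s] times the product of [ph] over the children, and
    [1 - g' s] into [(1 - g s) * ev s]. All values of [ph] then cancel except the one at the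
    root. *)
Lemma post_treeE T : post_tree T = tree_weight T / ph root_node.
Proof.
have phN0 s : ph s != 0 by rewrite gt_eqF// phi_gt0.
have gI : \prod_(s in inners T) g' s = (\prod_(s in inners T) g s) *
    (\prod_(s in inners T) \prod_(m < M) ph (child s m)) /
    \prod_(s in inners T) ph s.
  rewrite -prodfV -!big_split; apply: eq_bigr => s /inners_inner si /=.
  by rewrite /post_g si.
have gL : \prod_(s in leaves T) (1 - g' s) =
    (\prod_(s in leaves T) (1 - g s)) * (\prod_(s in leaves T) ev s) /
    \prod_(s in leaves T) ph s.
  rewrite -prodfV -!big_split; apply: eq_bigr => s _ /=.
  apply: (canRL (mulfK (phN0 s))); rewrite mulrBl mul1r /post_g.
  have E := phiE x0 x pi' g mu Lam a b s; case: ifPn E => si E.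
    by rewrite divfK ?phN0// {1}E addrK.
  by rewrite mul0r subr0 g_leaf// subr0 mul1r.
have TE : (\prod_(s in inners T) ph s) * (\prod_(s in leaves T) ph s) =
    ph root_node * \prod_(s in inners T) \prod_(m < M) ph (child s m).
  by rewrite -prod_tree prod_tree_children.
have N1 : \prod_(s in inners T) ph s != 0 by apply/prodf_neq0.
have N2 : \prod_(s in leaves T) ph s != 0 by apply/prodf_neq0.
rewrite /post_tree gI gL /tree_weight /prior_tree.
apply: (canRL (mulfK (phN0 _))); rewrite -mulrA.
apply: (mulfI N1); apply: (mulfI N2).
move: TE (phN0 root_node) N1 N2.
set P1 := \prod_(s in inners T) ph s; set P2 := \prod_(s in leaves T) ph s.
set C := \prod_(s in inners T) \prod_(m < M) ph (child s m).
set A := \prod_(s in inners T) g s; set B := \prod_(s in leaves T) (1 - g s).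
set E := \prod_(s in leaves T) ev s; set r := ph root_node.
move=> TE r0 N1 N2.
transitivity (A * B * E * (r * C)); first by field; rewrite N1 N2.
by rewrite -TE; ring.
Qed.

Lemma sum_post_tree : \sum_(T : tree M D) post_tree T = 1.
Proof.
by apply: sum_tree_prob => // s si; rewrite /post_g (negPf si).
Qed.

(** No recursion over subtrees is involved: the value follows from [post_treeE] and total
    probability 1 of the splitting law [g']. *)
Lemma sum_tree_weight : \sum_(T : tree M D) tree_weight T = ph root_node.
Proof.
have r0 : ph root_node != 0 by rewrite gt_eqF// phi_gt0.
rewrite -[RHS]mul1r -sum_post_tree mulr_suml; apply: eq_bigr => T _.
by rewrite post_treeE divfK.
Qed.

Lemma prior_tree_ge0 T : 0 <= prior_tree g T.
Proof.
by rewrite mulr_ge0// prodr_ge0// => s _; have /andP[? ?] := g01 s;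
  rewrite ?subr_ge0.
Qed.

Lemma post_tree_ge0 T : 0 <= post_tree T.
Proof.
rewrite post_treeE divr_ge0 ?(ltW (phi_gt0 _))// mulr_ge0 ?prior_tree_ge0//.
by rewrite prodr_ge0// => s _; exact/ltW/evidence_gt0.
Qed.

(** * The expected log joint density and the update it determines *)

Context (W : node M D -> 'M[R]_(M, J.+1)).

Let context_density_gt0 t (U : context M D) : 0 < context_density x0 x W t U.
Proof.
apply: prodr_gt0 => s _; apply: prodr_gt0 => m _; rewrite exprn_gt0//.
rewrite /softmax divr_gt0 ?expR_gt0// (bigD1 m)//= ltr_wpDr ?expR_gt0//.
by rewrite sumr_ge0// => i _; exact: expR_ge0.
Qed.

Let leaf_normal T (p : param R K T) (t : 'I_n) (s : leaf T) : R :=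
  normal_pdf (((regressor x0 x K t)^T *m theta p s) 0 0)
    (Num.sqrt (tau p s)^-1) (x t 0).

Let leaf_normal_gt0 T (p : param R K T) t (s : leaf T) :
  param_dom p -> 0 < leaf_normal p t s.
Proof. by move=> dp; rewrite /leaf_normal normal_pdf_precisionE ?expR_gt0. Qed.

Let ln_obs_density T (p : param R K T) t (U : context M D) : param_dom p ->
  ln (obs_density x0 x p t U) =
  \sum_(s : leaf T) (prec (val s) (context_leaf U))%:R * ln (leaf_normal p t s).
Proof.
move=> dp; rewrite -[RHS]expRK expR_sum; congr ln; apply: eq_bigr => s _.
case: prec; last by rewrite mul0r expR0.
by rewrite mul1r lnK// posrE leaf_normal_gt0.
Qed.

Let obs_density_gt0 T (p : param R K T) t (U : context M D) : param_dom p ->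
  0 < obs_density x0 x p t U.
Proof.
by move=> dp; apply: prodr_gt0 => s _; rewrite exprn_gt0//; exact: leaf_normal_gt0.
Qed.

Let prior_param_gt0 T (p : param R K T) : param_dom p ->
  0 < prior_param mu Lam a b p.
Proof.
by move=> dp; apply: prodr_gt0 => s _; exact: normal_gamma_pdf_gt0.
Qed.

(** The part of the exponent that depends on neither the tree nor its parameters; the additive
    constant of the update absorbs it. *)
Definition expected_log_contexts : R := \sum_(t < n) \sum_(u : context M D)
  q_context pi' t u * ln (context_density x0 x W t u).

Local Notation post_density p := (leaves_density mu' Lam' a' b' p).

Let sum_ln_obs T (p : param R K T) : param_dom p ->
  \sum_(t < n) \sum_(u : context M D)
    q_context pi' t u * ln (obs_density x0 x p t u) =
  \sum_(s : leaf T) \sum_(t < n)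
    q_node pi' (val s) t * ln (leaf_normal p t s).
Proof.
move=> dp; rewrite [RHS]exchange_big; apply: eq_bigr => t _.
under [LHS]eq_bigr => u _ do rewrite (ln_obs_density _ _ dp) mulr_sumr.
rewrite exchange_big; apply: eq_bigr => s _.
rewrite -(sum_q_context_prec M0 pi'_sum) mulr_suml [RHS]big_mkcond.
by apply: eq_bigr => u _; case: ifP; rewrite ?mul1r// mul0r mulr0.
Qed.

Let prior_leavesE T (p : param R K T) : param_dom p ->
  prior_param mu Lam a b p * expR (\sum_(s : leaf T) \sum_(t < n)
    q_node pi' (val s) t * ln (leaf_normal p t s)) =
  (\prod_(s in leaves T) ev s) * post_density p.
Proof.
move=> dp; rewrite /prior_param expR_sum -big_split /=.
have -> : \prod_(s in leaves T) ev s = \prod_(s : leaf T) ev (val s).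
  exact: big_sub.
rewrite /leaves_density -big_split /=.
apply: eq_bigr => s _.
exact: normal_gamma_conjugate (dp s).
Qed.

(** If the prior of [T] vanishes, both sides are -oo. Otherwise all densities involved are positive
    and the identity is one between real numbers. *)
Lemma expected_log_jointE T (p : param R K T) : param_dom p ->
  (expected_log_joint x0 x pi' W g mu Lam a b p =
   lne (tree_weight T * post_density p)%:E + expected_log_contexts%:E)%E.
Proof.
move=> dp; have [prior0|priorN0] := eqVneq (prior_tree g T) 0.
  rewrite /tree_weight prior0 !mul0r le0_lneNy// addNye//.
  apply/eqP; rewrite /expected_log_joint esum_eqNy; apply/existsP.
  (* Since [0 * -oo = 0], the sum is -oo only through a term of nonzero weight; one exists because
     the weights sum to 1. *)
  have [U qU] : exists U, q_contexts pi' U != 0.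
    apply/existsP; rewrite -[X in is_true X]negbK; apply/negP => /existsPn q0.
    have := sum_q_contexts M0 pi'_sum; rewrite big1 => [/eqP|U _].
      by rewrite eq_sym oner_eq0.
    by apply/eqP; have := q0 U; rewrite negbK.
  exists U; apply/andP; split=> //.
  rewrite /joint_density prior0 !mul0r le0_lneNy//.
  by rewrite gt0_muleNy// lte_fin lt_def qU q_contexts_ge0.
have prior_gt0 : 0 < prior_tree g T by rewrite lt_def priorN0 prior_tree_ge0.
have prior_pos := prior_param_gt0 dp.
have lnjE U : ln (joint_density x0 x W g mu Lam a b p U) =
    ln (prior_tree g T) + ln (prior_param mu Lam a b p) + \sum_(t < n)
      (ln (context_density x0 x W t (U t)) + ln (obs_density x0 x p t (U t))).
  rewrite -[RHS]expRK !expRD expR_sum !lnK ?posrE//; congr (ln (_ * _)).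
  by apply: eq_bigr => t _; rewrite expRD !lnK ?posrE ?obs_density_gt0.
have jgt0 U : 0 < joint_density x0 x W g mu Lam a b p U.
  apply: mulr_gt0; first exact: mulr_gt0.
  by apply: prodr_gt0 => t _; apply: mulr_gt0; last exact: obs_density_gt0.
have w_gt0 : 0 < tree_weight T * post_density p.
  rewrite mulr_gt0//; last first.
    apply: leaves_density_gt0 => // s.
    - exact: post_Lam_posdef.
    - exact: post_a_gt0.
    - exact: post_b_gt0.
  by rewrite mulr_gt0// prodr_gt0// => s _; exact: evidence_gt0.
rewrite lne_EFin// -EFinD /expected_log_joint.
under eq_bigr do rewrite lne_EFin// -EFinM lnjE.
rewrite sumEFin; congr EFin.
under eq_bigr do rewrite mulrDr mulr_sumr.
rewrite big_split /= -mulr_suml (sum_q_contexts M0 pi'_sum) mul1r exchange_big /=.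
under eq_bigr do rewrite (sum_q_contexts_marginal M0 pi'_sum _
  (fun u => ln (context_density x0 x W _ u) + ln (obs_density x0 x p _ u))).
have -> : \sum_(t < n) \sum_(u : context M D) q_context pi' t u *
    (ln (context_density x0 x W t u) + ln (obs_density x0 x p t u)) =
  expected_log_contexts + \sum_(s : leaf T) \sum_(t < n)
    q_node pi' (val s) t * ln (leaf_normal p t s).
  rewrite -sum_ln_obs// /expected_log_contexts -big_split; apply: eq_bigr => t _.
  by rewrite -big_split; apply: eq_bigr => u _; rewrite mulrDr.
rewrite addrCA addrC; congr (_ + _).
rewrite -[LHS]expRK !expRD !lnK ?posrE//; congr ln.
by rewrite -mulrA prior_leavesE// /tree_weight mulrA.
Qed.

(** Exponentiating gives [q] up to a factor [kap], and total mass 1 forces [kap] to be the inverse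
    of [phi] at the root. *)
Lemma is_variational_updateP (q : forall T : tree M D, param R K T -> R) :
  is_variational_update x0 x pi' W g mu Lam a b q <->
  is_density q /\ forall T (p : param R K T), param_dom p ->
    q T p = post_tree T * post_density p.
Proof.
have Z0 := phi_gt0 root_node.
have pd_gt0 T (p : param R K T) : param_dom p -> 0 < post_density p.
  apply: leaves_density_gt0 => s.
  - exact: post_Lam_posdef.
  - exact: post_a_gt0.
  - exact: post_b_gt0.
have w_ge0 T : 0 <= tree_weight T.
  by rewrite mulr_ge0 ?prior_tree_ge0// prodr_ge0// => s _; exact/ltW/evidence_gt0.
split=> [[dq [c qE]]|[dq qE]]; split=> //.
  have [q0 _ q1] := dq.
  pose kap := expR (expected_log_contexts + c).
  have qE' T (p : param R K T) : param_dom p ->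
      q T p = kap * tree_weight T * post_density p.
    move=> dp; have := qE T p dp; have := q0 T p dp.
    rewrite expected_log_jointE// -addeA -EFinD -mulrA.
    (* Where the weight is 0 the equation reads [lne (q T p) = -oo], which with nonnegativity gives
       [q T p = 0]. *)
    have := mulr_ge0 (w_ge0 T) (ltW (pd_gt0 T p dp)).
    rewrite le_eqVlt => /predU1P[<-|w0].
      rewrite (@le0_lneNy _ 0%:E)// addNye// mulr0 le_eqVlt => /predU1P[<-//|q_gt0].
      by rewrite lne_EFin.
    rewrite le_eqVlt => /predU1P[<-|q_gt0].
      by rewrite le0_lneNy// lne_EFin.
    rewrite !lne_EFin// -EFinD => -[/(congr1 expR)].
    by rewrite expRD !lnK ?posrE// mulrC.
  have : kap * phi x0 x pi' g mu Lam a b root_node = 1.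
    apply: EFin_inj; rewrite -q1 -sum_tree_weight mulr_sumr -sumEFin.
    apply: eq_bigr => T _; rewrite -[LHS](@integral_leaves_density R M D K T
      mu' Lam' a' b' post_Lam_posdef post_a_gt0 post_b_gt0); last first.
      by rewrite mulr_ge0 ?expR_ge0.
    by apply: eq_integral => p; rewrite inE => dp; rewrite qE'.
  move=> kZ T p dp; rewrite qE'// post_treeE; congr (_ * _).
  rewrite mulrC; congr (_ * _); rewrite -[RHS]mul1r.
  by apply: (canRL (mulfK _)) kZ; rewrite gt_eqF.
(* The constant removes the context part and normalizes by [phi] at the root. *)
exists (- expected_log_contexts - ln (phi x0 x pi' g mu Lam a b root_node)).
move=> T p dp; rewrite expected_log_jointE// -addeA -EFinD addrA subrr add0r.
rewrite qE// post_treeE mulrAC.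
have := mulr_ge0 (w_ge0 T) (ltW (pd_gt0 T p dp)).
rewrite le_eqVlt => /predU1P[<-|w0]; first by rewrite mul0r le0_lneNy// addNye.
by rewrite !lne_EFin ?divr_gt0// ln_div ?posrE.
Qed.

Lemma post_density_is_density :
  is_density (fun T (p : param R K T) => post_tree T * post_density p).
Proof.
have pL := post_Lam_posdef; have pa := post_a_gt0; have pb := post_b_gt0.
split.
- move=> T p dp; rewrite mulr_ge0 ?post_tree_ge0//.
  by apply/ltW/leaves_density_gt0.
- by move=> T; apply: measurable_funM => //; exact: measurable_leaves_density.
- rewrite -[RHS](congr1 EFin sum_post_tree) -sumEFin; apply: eq_bigr => T _.
  by rewrite integral_leaves_density// post_tree_ge0.
Qed.

End posterior.

Theorem proposition2 (R : realType) (M D J K n : nat)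
  (hM : (0 < M)%N) (hD : (0 < D)%N) (hJ : (0 < J)%N) (hK : (0 < K)%N)
  (hn : (0 < n)%N)
  (x0 : 'cV[R]_(maxn J K)) (x : 'cV[R]_n)
  (W : node M D -> 'M[R]_(M, J.+1))
  (g : node M D -> R)
  (hg : forall s : node M D, 0 <= g s <= 1)
  (hg_leaf : forall s : node M D, ~~ inner s -> g s = 0)
  (mu : 'cV[R]_K.+1) (Lam : 'M[R]_K.+1) (hLam : posdefmx Lam)
  (a b : R) (ha : 0 < a) (hb : 0 < b)
  (pi' : 'I_n -> node M D -> 'I_M -> R)
  (hpi_ge0 : forall (t : 'I_n) (s : node M D) (m : 'I_M), inner s ->
    0 <= pi' t s m)
  (hpi_sum : forall (t : 'I_n) (s : node M D), inner s ->
    \sum_(m < M) pi' t s m = 1) :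
  (exists q : forall T : tree M D, param R K T -> R,
     is_variational_update x0 x pi' W g mu Lam a b q) /\
  forall q : forall T : tree M D, param R K T -> R,
    is_variational_update x0 x pi' W g mu Lam a b q ->
    let g' := post_g x0 x pi' g mu Lam a b in
    let Lam' := post_Lam x0 x pi' Lam in
    let mu' := post_mu x0 x pi' mu Lam in
    let a' := post_a pi' a in
    let b' := post_b x0 x pi' mu Lam b in
    let qT (T : tree M D) :=
      (\prod_(s in inners T) g' s) * \prod_(s in leaves T) (1 - g' s) in
    let q_leaf (s : node M D) (th : 'cV[R]_K.+1) (ta : R) :=
      mvnormal_pdf (mu' s) (invmx (ta *: Lam' s)) th *
      gamma_pdf (a' s) (b' s) ta in
    (forall T : tree M D, (\int[param_lebesgue R K T]_(p in @param_dom M D R K T)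
                  (q T p)%:E = (qT T)%:E)%E) /\
    (forall (T : tree M D) (p : param R K T), param_dom p ->
       q T p = qT T * \prod_(s : leaf T) q_leaf (val s) (theta p s) (tau p s)).
Proof.
have update q := is_variational_updateP x0 x mu hM hpi_ge0 hpi_sum hLam ha hb hg
  hg_leaf W q.
split.
  (* The witness is read off the closed formula, which holds by reflexivity; being a density is the
     remaining claim. *)
  eexists; apply/update; split=> //.
  exact: post_density_is_density.
move=> q /update[_ qE] g' Lam' mu' a' b' qT q_leaf; split=> [T|]; last exact: qE.
rewrite -[RHS](@integral_leaves_density R M D K T mu' Lam' a' b').
- by apply: eq_integral => p; rewrite inE => dp; rewrite qE.
- by move=> s; exact: post_Lam_posdef.
- by move=> s; exact: post_a_gt0.
- by move=> s; exact: post_b_gt0.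
- by apply: post_tree_ge0.
Qed.
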